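(* Let $U,V\subset\mathbb{R}^2$ be open, let $\phi:U\to V$ be a $C^2$ diffeomorphism, let $F\subset U$ be compact, let $0<\kappa\le\frac12$ and $C>0$. Then for every $\delta>0$ and every $(\kappa,C,\delta)$-unrectifiable one-set $\mathcal{A}\subset F$, the set $\phi(\mathcal{A})$ is equivalent to a $(\kappa/2,\tilde C,\delta)$-unrectifiable one-set with $\tilde C\sim C$. All implicit constants may depend on $C$, $\kappa$, $\phi$ and $F$, but not on $\delta$ (nor on $\mathcal{A}$).
   Context: $|\cdot|$ is Lebesgue measure; $\ell^\rho$ is the $\rho$-neighbourhood of a line $\ell$; $X\sim Y$ means that $X$ and $Y$ are comparable up to multiplicative constants with the stated dependence. Let $\delta>0$, $C>0$. A set $\mathcal{A}\subset\mathbb{R}^2$ is a $(1,C,\delta)$-set that is unconcentrated on lines if: (i) $\mathcal{A}$ is a non-empty union of closed balls of radius $\delta$ with at most $C$-fold overlap (every $x\in\mathbb{R}^2$ belongs to at most $C$ of the balls); (ii) $C^{-1}\delta\le|\mathcal{A}|\le C\delta$; (iii) for every ball $B$ of radius $r$, $|\mathcal{A}\cap B|\le Cr|\mathcal{A}|$; (iv) for every line $\ell$, $|\mathcal{A}\cap\ell^{1/C}|\le|\mathcal{A}|/10$. For $0<\kappa\le\frac12$, $\mathcal{A}$ is a $(\kappa,C,\delta)$-unrectifiable one-set if it is a $(1,C,\delta)$-set that is unconcentrated on lines and for every rectangle $R$ (of any orientation) with side lengths $r_1\le r_2$, $|\mathcal{A}\cap R|\le Cr_1^{\kappa}r_2^{1-\kappa}|\mathcal{A}|$.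 A set $\mathcal{A}$ is equivalent to a $(\kappa,C,\delta)$-unrectifiable one-set if there are $(\kappa,C_i,\delta_i)$-unrectifiable one-sets $\mathcal{A}_1,\mathcal{A}_2$, with $C_i\sim C$ and $\delta_i\sim\delta$ $(i=1,2)$, such that $\mathcal{A}_1\subset\mathcal{A}\subset\mathcal{A}_2$. *)

(* Defs.v *)
From HB Require Import structures.
From mathcomp Require Import all_boot all_order all_algebra.
From mathcomp Require Import all_classical all_reals all_analysis.

Set Implicit Arguments.
Unset Strict Implicit.
Unset Printing Implicit Defensive.

Import Order.TTheory GRing.Theory Num.Theory.
Import numFieldNormedType.Exports.

Local Open Scope classical_set_scope.
Local Open Scope ring_scope.

Section Plane.
Context {R : realType}.
Implicit Types (p q u v x y : R * R) (A B E L : set (R * R)).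

(* The library norm on [R * R] is the sup norm, so the Euclidean metric is
   introduced separately; both induce the same topology and the same notion
   of differentiability. *)
Definition eucl_dist x y : R :=
  Num.sqrt ((x.1 - y.1) ^+ 2 + (x.2 - y.2) ^+ 2).

Definition edisk x (r : R) : set (R * R) := [set y | eucl_dist x y <= r].

Definition line p v : set (R * R) := [set p + t *: v | t in [set: R]].

Definition is_line L : Prop := exists p v, v != 0 /\ L = line p v.

Definition nbhd L (rho : R) : set (R * R) :=
  [set x | exists2 y, L y & eucl_dist x y < rho].

(* [p] is a corner; the side of length [r1] has the direction of the unit
   vector [u], the side of length [r2] that of [u] rotated by a quarter turn. *)
Definition rectangle p u (r1 r2 : R) : set (R * R) :=
  [set x | exists s t : R, [/\ 0 <= s <= r1, 0 <= t <= r2 &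
     x = p + s *: u + t *: (- u.2, u.1)]].

Definition area : set (R * R) -> \bar R :=
  (@lebesgue_measure R \x @lebesgue_measure R)%E.

(* [E] is the set of centres of the balls. *)
Definition is_ball_union (C delta : R) A : Prop :=
  exists E, [/\ E !=set0,
    A = \bigcup_(c in E) edisk c delta &
    forall x, exists2 n : nat, n%:R <= C &
      (E `&` [set c | edisk c delta x] #<= `I_n)%card].

Definition unconcentrated_one_set (C delta : R) A : Prop :=
  [/\ is_ball_union C delta A,
      ((C^-1 * delta)%:E <= area A <= (C * delta)%:E)%E,
      forall x (r : R), 0 < r ->
        (area (A `&` edisk x r) <= (C * r)%:E * area A)%E &
      forall L, is_line L ->
        (area (A `&` nbhd L C^-1) <= (10^-1)%:E * area A)%E].

Definition unrectifiable_one_set (kappa C delta : R) A : Prop :=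
  unconcentrated_one_set C delta A /\
  forall p u (r1 r2 : R), eucl_dist u 0 = 1 -> 0 < r1 -> r1 <= r2 ->
    (area (A `&` rectangle p u r1 r2) <=
       (C * r1 `^ kappa * r2 `^ (1 - kappa))%:E * area A)%E.

(* [X ~ Y] with implicit constant [K]. *)
Definition comparable_upto (K X Y : R) : Prop := K^-1 * Y <= X <= K * Y.

Definition equivalent_to_unrectifiable (K kappa C delta : R) B : Prop :=
  exists (C1 C2 delta1 delta2 : R) (A1 A2 : set (R * R)),
    [/\ comparable_upto K C1 C /\ comparable_upto K C2 C,
        comparable_upto K delta1 delta /\ comparable_upto K delta2 delta,
        unrectifiable_one_set kappa C1 delta1 A1 /\
        unrectifiable_one_set kappa C2 delta2 A2 &
        A1 `<=` B /\ B `<=` A2].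

End Plane.

(* [f] is of class C^k on the open set [U].  In finite dimension, continuity of
   the differential is continuity of each directional derivative ['D_v f]. *)
Fixpoint class_C (R : realType) (k : nat) (U : set (R * R))
    (f : R * R -> R * R) : Prop :=
  if k is k'.+1 then
    (forall x, U x -> differentiable f x) /\
    (forall v, class_C k' U ('D_v f))
  else forall x, U x -> {for x, continuous f}.

(* [phi] is a total function; its values outside [U] play no role. *)
Definition C2_diffeomorphism (R : realType) (U V : set (R * R))
    (phi : R * R -> R * R) : Prop :=
  exists psi : R * R -> R * R,
    [/\ (forall x, U x -> V (phi x)) /\ (forall y, V y -> U (psi y)),
        (forall x, U x -> psi (phi x) = x) /\
        (forall y, V y -> phi (psi y) = y),
        class_C 2 U phi & class_C 2 V psi].

(* Main.v *)
Require Import Defs.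
From mathcomp Require Import all_boot all_order all_algebra.
From mathcomp Require Import all_classical all_reals all_analysis.
From mathcomp Require Import measurable_realfun ring lra.

(* The set phi(A) lies between the unions of the disks of radius d/L and L*d
   about the images phi(c) of the centres c of A, and both unions are
   unrectifiable.  All the measure estimates reduce to counting centres: by
   bounded overlap, the number of disks of A inside a set T is at most a constant
   times |A n T| / d^2.  The inverse of phi maps the part of a rectangle of width
   r and length sqrt r into a rectangle of width about r and length about sqrt r,
   by Taylor's formula to second order.  Cutting a rectangle of sides r <= s into
   about s / sqrt r such pieces, on each of which the count is at most
   r^kappa (sqrt r)^(1 - kappa), gives s r^(kappa/2), which is the loss of the
   factor 2 in the exponent.  The rectangle estimate implies the other
   conditions; in particular non-concentration on lines holds because a thin
   neighbourhood of a line meets the bounded set phi(A) in a thin rectangle. *)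

Set Implicit Arguments.
Unset Strict Implicit.
Unset Printing Implicit Defensive.

Import Order.TTheory GRing.Theory Num.Theory.
Import numFieldNormedType.Exports.

Local Open Scope classical_set_scope.
Local Open Scope ring_scope.

(** * Area and packing *)

Section Area.
Context {R : realType}.
Implicit Types (x y : R * R) (X Y : set (R * R)).

Lemma norm2_le x r : (`|x| <= r) = (`|x.1| <= r) && (`|x.2| <= r).
Proof. by rewrite prod_normE ge_max. Qed.

Lemma le_integral_nonneg d (T : measurableType d)
    (mu : {measure set T -> \bar R}) (f g : T -> \bar R) :
  (forall t, 0 <= f t)%E -> (forall t, f t <= g t)%E ->
  (\int[mu]_t f t <= \int[mu]_t g t)%E.
Proof.
move=> f0 fg; rewrite !ge0_integralTE//; last by move=> t; exact: le_trans (fg t).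
apply: ereal_sup_le => _ [h hf <-]; exists h => // t.
exact: le_trans (hf t) (fg t).
Qed.

(* [area] is monotone also on non-measurable sets: [lebesgue_measure] is the
   outer measure itself and the integral of a nonnegative function is
   a supremum over simple functions. *)
Lemma le_area X Y : X `<=` Y -> (area X <= area Y)%E.
Proof.
move=> XY; apply: le_integral_nonneg => t //=.
apply: (@le_outer_measure _ _ (mu_ext _)).
by move=> z; rewrite /xsection/= !inE => /XY.
Qed.

(** Closed ball of the sup norm: a square, hence a product of intervals with an explicit area. Disks
    are compared with squares, and the area of a disk is never computed. *)
Definition box x (r : R) : set (R * R) := [set y | `|y - x| <= r].

Lemma boxE x r :
  box x r = `[x.1 - r, x.1 + r]%classic `*` `[x.2 - r, x.2 + r]%classic.
Proof.
by apply/seteqP; split => y; rewrite /box /= norm2_le !ler_distl !in_itv/=;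
  [move=> /andP[]|move=> [-> ->]].
Qed.

Lemma measurable_box x r : measurable (box x r).
Proof. by rewrite boxE; apply: measurableX; exact: measurable_itv. Qed.

Lemma area_box x r : 0 <= r -> area (box x r) = (4 * r ^+ 2)%:E.
Proof.
move=> r0; rewrite boxE /area product_measure1E; [|exact: measurable_itv..].
have H (a : R) : lebesgue_measure `[a - r, a + r]%classic = (2 * r)%:E.
  rewrite lebesgue_measure_itv/= lte_fin; case: ltP => [_|].
    by rewrite -EFinB; congr EFin; ring.
  by move=> ?; congr EFin; lra.
by rewrite [X in (X * _)%E]H [X in (_ * X)%E]H -EFinM; congr EFin; ring.
Qed.

Lemma area_bigcup_box (s : seq ((R * R) * R)) :
  all (fun b => 0 <= b.2) s ->
  (area (\big[setU/set0]_(b <- s) box b.1 b.2)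
     <= (\sum_(b <- s) 4 * b.2 ^+ 2)%:E)%E.
Proof.
elim: s => [_|b s IH /= /andP[b0 /IH{}IH]].
  by rewrite !big_nil /area measure0.
rewrite !big_cons EFinD -(area_box b.1)//.
apply: le_trans (leeD _ IH); last exact: lexx.
apply: measureU2; first exact: measurable_box.
by apply: bigsetU_measurable => *; exact: measurable_box.
Qed.

(** Upper bounds on area are witnessed by finite covers with squares: they pass to subsets and add
    up over finite unions even when [X] is not known to be measurable. *)
Definition box_coverable X (v : R) : Prop := exists s : seq ((R * R) * R),
  [/\ all (fun b => 0 <= b.2) s, X `<=` \big[setU/set0]_(b <- s) box b.1 b.2
    & \sum_(b <- s) 4 * b.2 ^+ 2 <= v].

Lemma box_coverable_area X v : box_coverable X v -> (area X <= v%:E)%E.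
Proof.
move=> [s [s0 Xs sv]]; apply: le_trans (le_area Xs) _.
by apply: le_trans (area_bigcup_box s0) _; rewrite lee_fin.
Qed.

Lemma box_coverable_sub {X Y} {v w : R} : X `<=` Y -> v <= w ->
  box_coverable Y v -> box_coverable X w.
Proof.
move=> XY vw [s [s0 Ys sv]]; exists s; split => //.
  exact: subset_trans Ys.
exact: le_trans vw.
Qed.

Lemma box_coverable_bigcup (I : eqType) (s : seq I) (F : I -> set (R * R)) v :
  (forall i, i \in s -> box_coverable (F i) v) ->
  box_coverable (\big[setU/set0]_(i <- s) F i) ((size s)%:R * v).
Proof.
elim: s => [_|i s IH h].
  by exists [::]; rewrite !big_nil mul0r; split.
have [l1 [l10 Fl1 l1v]] := h i (mem_head _ _).
have [l2 [l20 Fl2 l2v]] : box_coverable (\big[setU/set0]_(i <- s) F i) ((size s)%:R * v).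
  by apply: IH => j js; apply: h; rewrite in_cons js orbT.
exists (l1 ++ l2); rewrite all_cat l10 l20 !big_cat big_cons; split => //=.
  by apply: setUSS.
by rewrite -[(size s).+1]add1n natrD mulrDl mul1r lerD.
Qed.

Lemma box_coverable_box x r : 0 <= r -> box_coverable (box x r) (4 * r ^+ 2).
Proof.
move=> r0; exists [:: (x, r)]; rewrite /= r0; split => //.
  by rewrite big_seq1.
by rewrite big_seq1.
Qed.

(* Integrate the sum of the indicators of the boxes. *)
Lemma packing (s : seq (R * R)) (n : nat) (r : R) : 0 <= r ->
  (forall y, (count (fun c => `|y - c| <= r)%R s <= n)%N) ->
  (((size s)%:R * (4 * r ^+ 2))%:E
    <= (n%:R)%:E * area (\big[setU/set0]_(c <- s) box c r))%E.
Proof.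
move=> r0 sn.
(* At [y] the sum counts the centres within [r] of [y]: at most [n], and none unless [y] lies in the
   union. *)
have key (y : R * R) : \sum_(c <- s) (\1_(box c r) y : R) <=
    n%:R * \1_(\big[setU/set0]_(c <- s) box c r) y.
  rewrite (eq_bigr (fun c => ((`|y - c| <= r)%R : nat)%:R)); last first.
    by move=> c _; rewrite indicE; congr ((nat_of_bool _)%:R); apply/idP/idP; rewrite inE.
  rewrite -natr_sum -big_mkcond /= sum1_count indicE -natrM ler_nat.
  have [/eqP ->//|sy] := boolP (count (fun c => `|y - c| <= r)%R s == 0%N).
  suff -> : y \in \big[setU/set0]_(c <- s) box c r by rewrite muln1.
  have /hasP[c cs yc] : has (fun c => `|y - c| <= r)%R s by rewrite has_count lt0n.
  by rewrite inE -bigcup_seq; exists c.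
rewrite /area; set mu := (_ \x _)%E.
set W := \big[setU/set0]_(c <- s) box c r.
have mW : measurable W by apply: bigsetU_measurable => *; exact: measurable_box.
have -> : ((size s)%:R * (4 * r ^+ 2))%:E =
    (\int[mu]_y \sum_(c <- s) (\1_(box c r) y)%:E)%E.
  rewrite ge0_integral_sum//; last first.
    by move=> c; apply/measurable_EFinP; apply: measurable_indic; exact: measurable_box.
  rewrite (eq_bigr (fun=> (4 * r ^+ 2)%:E)); last first.
    move=> c _; rewrite integral_indic//; last exact: measurable_box.
    by rewrite setIT -(area_box c).
  rewrite sumEFin; congr EFin.
  by rewrite big_const_seq count_predT iter_addr_0 mulr_natl.
have -> : ((n%:R)%:E * area W = \int[mu]_y ((n%:R)%:E * (\1_W y)%:E))%E.
  have mf : measurable_fun setT (fun y : R * R => (\1_W y)%:E : \bar R).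
    by apply/measurable_EFinP; exact: measurable_indic.
  by rewrite ge0_integralZl// integral_indic// setIT.
apply: le_integral_nonneg => y.
  by apply: sume_ge0 => c _; rewrite lee_fin indicE.
by rewrite sumEFin -EFinM lee_fin; exact: key.
Qed.
End Area.

(** * Differential calculus in the plane *)

Section Calculus.
Context {R : realType}.
Implicit Types (x y h : R * R) (f : R * R -> R * R).

Lemma derive_components f x h : differentiable f x ->
  'D_h f x = h.1 *: 'D_(1, 0) f x + h.2 *: 'D_(0, 1) f x.
Proof.
move=> df; rewrite !deriveE// -!linearZ -linearD; congr ('d f x _).
by case: h => a b; congr pair => /=; rewrite /GRing.scale/=; ring.
Qed.

(** The scalar mean value theorem along the segment, for one coordinate [p] of [f]; an abstract [p]
    lets both projections share the proof. *)
Lemma coordinate_increment (p : R * R -> R) f x h q (M : R) :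
  (forall x y, p (x - y) = p x - p y) -> (forall a x, p (a *: x) = a * p x) ->
  (forall x, p @ x --> p x) -> (forall z, `|p z| <= `|z|) ->
  (forall t : R, 0 <= t <= 1 -> differentiable f (x + t *: h)) ->
  (forall t : R, 0 <= t <= 1 -> `|'D_h f (x + t *: h) - q| <= M) ->
  `|p (f (x + h) - f x - q)| <= M.
Proof.
move=> pB pZ cp p1 df DM.
pose g (t : R) : R := p (f (x + t *: h)).
pose dg (t : R) : R := p ('D_h f (x + t *: h)).
have gd (t : R) : 0 <= t <= 1 -> is_derive t 1 g (dg t).
  move=> t01; have /diff_derivable dh := df t t01.
  have cv : (fun s : R => s^-1 *: ((g \o shift t) (s *: 1) - g t)) @ 0^' --> dg t.
    have -> : (fun s : R => s^-1 *: ((g \o shift t) (s *: 1) - g t)) =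
      p \o (fun s : R => s^-1 *: ((f \o shift (x + t *: h)) (s *: h) - f (x + t *: h))).
      apply/funext => s /=; rewrite /g /shift pZ pB.
      have -> : x + (s *: 1 + t) *: h = s *: h + (x + t *: h).
        by rewrite [s *: 1]mulr1 scalerDl addrCA.
      by [].
    have dh' : (fun s : R => s^-1 *: ((f \o shift (x + t *: h)) (s *: h) - f (x + t *: h)))
        @ 0^' --> 'D_h f (x + t *: h) := dh h.
    by apply: (cvg_comp _ _ dh'); 
    exact: cp.
  split; first by apply/cvg_ex; exists (dg t).
  by apply/cvg_lim.
have cg : {within `[0, 1], continuous g}.
  apply: derivable_within_continuous => t; rewrite in_itv/= => t01.
  by have [] := gd t t01.
have [|c c01 E] := MVT_segment ler01 _ cg (df := dg).
  by move=> t; rewrite in_itv/= => /andP[t0 t1]; apply: gd; rewrite !ltW.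
rewrite 2!pB.
have -> : p (f (x + h)) - p (f x) = g 1 - g 0 by rewrite /g scale1r scale0r addr0.
rewrite E subr0 mulr1 /dg -pB; apply: le_trans (p1 _) _; apply: DM.
by move: c01; rewrite in_itv.
Qed.

(** The sup norm allows the coordinates to be treated separately, so their intermediate points may
    differ. The vector [q] is free: 0 gives a Lipschitz bound, the derivative at [x] gives Taylor's
    formula. *)
Lemma mean_value_inequality f x h q (M : R) :
  (forall t : R, 0 <= t <= 1 -> differentiable f (x + t *: h)) ->
  (forall t : R, 0 <= t <= 1 -> `|'D_h f (x + t *: h) - q| <= M) ->
  `|f (x + h) - f x - q| <= M.
Proof.
move=> df DM; rewrite norm2_le; apply/andP; split.
- apply: (@coordinate_increment fst f x h q M) => //.
    by move=> z; exact: cvg_fst.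
  by move=> z; rewrite [leRHS]prod_normE le_max lexx.
- apply: (@coordinate_increment snd f x h q M) => //.
    by move=> z; exact: cvg_snd.
  by move=> z; rewrite [leRHS]prod_normE le_max lexx orbT.
Qed.

Lemma combinationB (a b : R) x1 y1 x2 y2 :
  a *: x1 + b *: y1 - (a *: x2 + b *: y2) = a *: (x1 - x2) + b *: (y1 - y2).
Proof. by rewrite opprD addrACA -!scalerBr. Qed.

Lemma norm_combination_le (a b : R) x y : `|a *: x + b *: y| <= `|a| * `|x| + `|b| * `|y|.
Proof. by rewrite -(normrZ a) -(normrZ b) ler_normD. Qed.

Lemma sum2_mul_le (p q a b P A : R) : 0 <= p <= P -> 0 <= q <= P ->
  0 <= a <= A -> 0 <= b <= A -> p * a + q * b <= 2 * A * P.
Proof.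
move=> /andP[p0 pP] /andP[q0 qP] /andP[a0 aA] /andP[b0 bA].
have := ler_pM p0 a0 pP aA; have := ler_pM q0 b0 qP bA; lra.
Qed.

Lemma norm_fst h : `|h.1| <= `|h|.
Proof. by rewrite [leRHS]prod_normE le_max lexx. Qed.

Lemma norm_snd h : `|h.2| <= `|h|.
Proof. by rewrite [leRHS]prod_normE le_max lexx orbT. Qed.

Definition partials_bounded f (K : set (R * R)) (M : R) : Prop :=
  forall x, K x -> [/\ differentiable f x, `|'D_(1, 0) f x| <= M &
    `|'D_(0, 1) f x| <= M].

Lemma partials_bounded_derive f K (M : R) x h : partials_bounded f K M -> K x ->
  `|'D_h f x| <= 2 * M * `|h|.
Proof.
move=> fKM /fKM[df D1 D2]; rewrite derive_components//.
apply: le_trans (norm_combination_le _ _ _ _) _.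
apply: sum2_mul_le; apply/andP; split;
  [exact: normr_ge0|exact: norm_fst|exact: normr_ge0|exact: norm_snd|
   exact: normr_ge0|exact: D1|exact: normr_ge0|exact: D2].
Qed.

Definition segment_in (K : set (R * R)) x y : Prop :=
  forall t : R, 0 <= t <= 1 -> K (x + t *: (y - x)).

Lemma partials_bounded_lipschitz f K (M : R) x y : partials_bounded f K M ->
  segment_in K x y -> `|f y - f x| <= 2 * M * `|y - x|.
Proof.
move=> fKM sK.
have := @mean_value_inequality f x (y - x) 0 (2 * M * `|y - x|).
rewrite subr0 [x + _]addrC subrK; apply => t t01; first by have [] := fKM _ (sK t t01).
by rewrite subr0; apply: partials_bounded_derive fKM (sK t t01).
Qed.

Lemma segment_in_sub K x y (t : R) : 0 <= t <= 1 -> segment_in K x y ->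
  segment_in K x (x + t *: (y - x)).
Proof.
move=> /andP[t0 t1] sK s /andP[s0 s1].
rewrite [x + t *: _]addrC addrK scalerA; apply: sK.
by rewrite mulr_ge0//= mulr_ile1.
Qed.

(** The mean value inequality with [q] the derivative at [x]: along the segment each partial
    derivative moves by at most [2 * M] times the length, by the Lipschitz bound applied to it. *)
Lemma taylor2 f K (M : R) x y :
  partials_bounded f K M -> partials_bounded ('D_(1, 0) f) K M ->
  partials_bounded ('D_(0, 1) f) K M -> segment_in K x y ->
  `|f y - f x - 'D_(y - x) f x| <= 4 * M * `|y - x| ^+ 2.
Proof.
move=> fKM f1KM f2KM sK; set h := y - x.
have Kx : K x by have := sK 0; rewrite scale0r addr0; apply; rewrite lexx ler01.
have {1}-> : y = x + h by rewrite /h addrC subrK.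
apply: mean_value_inequality => t t01; first by have [] := fKM _ (sK t t01).
have [dx M1 _] := fKM _ Kx; have M0 : 0 <= M by apply: le_trans M1.
have [dt _ _] := fKM _ (sK t t01).
rewrite (derive_components h dt) (derive_components h dx) combinationB.
have lip g : partials_bounded g K M -> `|g (x + t *: h) - g x| <= 2 * M * `|h|.
  move=> gKM; apply: le_trans (partials_bounded_lipschitz gKM (segment_in_sub t01 sK)) _.
  rewrite [x + _]addrC addrK normrZ ler_wpM2l ?mulr_ge0//.
  by rewrite ler_piMl// ger0_norm; case/andP: t01.
apply: le_trans (norm_combination_le _ _ _ _) _.
have -> : 4 * M * `|h| ^+ 2 = 2 * (2 * M * `|h|) * `|h| by rewrite expr2; ring.
apply: sum2_mul_le; apply/andP; split;
  [exact: normr_ge0|exact: norm_fst|exact: normr_ge0|exact: norm_snd|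
   exact: normr_ge0|exact: lip _ f1KM|exact: normr_ge0|exact: lip _ f2KM].
Qed.

Lemma compact_continuous_bounded (K : set (R * R)) f : compact K ->
  (forall x, K x -> {for x, continuous f}) ->
  exists M : R, forall x, K x -> `|f x| <= M.
Proof.
move=> cK cf.
have /compact_bounded[N [_ hN]] : compact (f @` K).
  by apply: continuous_compact cK; apply: continuous_in_subspaceT => x; rewrite inE => /cf.
by exists (N + 1) => x Kx; apply: (hN (N + 1)); [rewrite ltrDl|exists x].
Qed.

Lemma partials_bounded_le f K (M N : R) : M <= N ->
  partials_bounded f K M -> partials_bounded f K N.
Proof.
by move=> MN fKM x /fKM[df D1 D2]; split => //; [exact: le_trans D1 MN|exact: le_trans D2 MN].
Qed.

Lemma class_C1_bounds (V K : set (R * R)) f : class_C 1 V f -> compact K -> K `<=` V ->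
  exists M : R, partials_bounded f K M.
Proof.
move=> [df Df] cK KV.
have [M1 h1] : exists M : R, forall x, K x -> `|'D_(1, 0) f x| <= M.
  by apply: compact_continuous_bounded cK _ => x /KV; exact: Df.
have [M2 h2] : exists M : R, forall x, K x -> `|'D_(0, 1) f x| <= M.
  by apply: compact_continuous_bounded cK _ => x /KV; exact: Df.
exists (Num.max M1 M2) => x Kx; split; first exact/df/KV.
  by apply: le_trans (h1 _ Kx) _; rewrite le_max lexx.
by apply: le_trans (h2 _ Kx) _; rewrite le_max lexx orbT.
Qed.

Definition thickening (K : set (R * R)) (e : R) : set (R * R) :=
  [set y | exists2 z, K z & `|y - z| <= e].

Lemma compact_box x (r : R) : compact (box x r).
Proof. by rewrite boxE; apply: compact_setX; exact: segment_compact. Qed.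

Lemma compact_thickening K e : compact K -> compact (thickening K e).
Proof.
move=> cK; have -> : thickening K e = (fun z : (R * R) * (R * R) => z.1 + z.2) @` (K `*`
  box 0 e).
  apply/seteqP; split => [y [z Kz yz]|_ [[z h] [/= Kz hz] <-]].
    by exists (z, y - z); rewrite /= ?[z + _]addrC ?subrK//; split => //; rewrite /box/= subr0.
  by exists z => //; rewrite [z + h]addrC addrK; move: hz; rewrite /box/= subr0.
apply: continuous_compact; last by apply: (compact_setX cK); exact: compact_box.
apply: continuous_subspaceT; exact: add_continuous.
Qed.

(** Around each point of [K] some radius works; compactness, in its near-covering form, makes one
    radius work for all of [K]. *)
Lemma thickening_sub_open (K V : set (R * R)) : compact K -> open V -> K `<=` V ->
  exists2 e : R, 0 < e & thickening K e `<=` V.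
Proof.
move=> /compact_near_coveringP cK oV KV.
have near_ball (x : R * R) (s : R) : 0 < s -> \forall x' \near x, `|x - x'| < s.
  by move=> s0; apply/nbhs_normP; exists s.
have : \forall e \near (0 : R)^'+, K `<=` (fun z => box z e `<=` V).
  apply: cK => x Kx; have /nbhs_normP[r /= r0 xrV] := open_nbhs_nbhs (conj oV (KV x Kx)).
  near=> x' e; move=> y /= yx'; apply: xrV => /=.
  rewrite -(subrKA x') (le_lt_trans (ler_normD _ _))// (splitr r) ltrD//.
    by near: x'; apply: near_ball; rewrite divr_gt0.
  rewrite distrC (le_lt_trans yx')//.
  by near: e; apply: nbhs_right_lt; rewrite divr_gt0.
move=> H; near (0 : R)^'+ => e; exists e; first by near: e; exact: nbhs_right_gt.
by move=> y [z Kz yz]; apply: (near H e) yz.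
Unshelve. all: by end_near. Qed.
End Calculus.

(** * Quantitative control of the diffeomorphism on a compact set *)

Section Control.
Context {R : realType}.
Implicit Types (x y h : R * R) (f : R * R -> R * R).

Lemma norm_le_eucl_dist x y : `|y - x| <= eucl_dist x y.
Proof.
rewrite norm2_le /eucl_dist -!sqrtr_sqr /= !ler_sqrt ?addr_ge0 ?sqr_ge0//.
rewrite -[y.1 - _]opprB -[y.2 - _]opprB !sqrrN.
by rewrite lerDl lerDr !sqr_ge0.
Qed.

Lemma eucl_dist_le x y (r : R) : 2 * `|y - x| <= r -> eucl_dist x y <= r.
Proof.
move=> yxr; have r0 : 0 <= r by apply: le_trans yxr; rewrite mulr_ge0.
rewrite /eucl_dist -(ger0_norm r0) -sqrtr_sqr ler_wsqrtr//.
have h1 := norm_fst (y - x); have h2 := norm_snd (y - x).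
have := ler_pM (normr_ge0 _) (normr_ge0 _) h1 h1.
have := ler_pM (normr_ge0 _) (normr_ge0 _) h2 h2.
have := ler_pM (mulr_ge0 (ler0n _ 2) (normr_ge0 _)) (mulr_ge0 (ler0n _ 2) (normr_ge0 _))
  yxr yxr.
rewrite -!expr2 !real_normK ?num_real//= => {h1 h2}.
have -> : (x.1 - y.1) ^+ 2 = (y.1 - x.1) ^+ 2 by ring.
have -> : (x.2 - y.2) ^+ 2 = (y.2 - x.2) ^+ 2 by ring.
have := sqr_ge0 `|y - x|; rewrite exprMn; lra.
Qed.

Lemma norm_sub_summand x y h (r : R) : `|x - (y + h)| <= r -> `|x - h| <= r + `|y|.
Proof.
move=> hr; have -> : x - h = x - (y + h) + y by rewrite opprD addrA [x - y - h]addrAC subrK.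
exact: le_trans (ler_normD _ _) (lerD hr (lexx _)).
Qed.

(** Since [F] need not be convex, the Lipschitz bound for [phi] is used only on segments from the
    centre of a disk contained in [F]. *)
Lemma segment_in_edisk c x (r : R) : edisk c r x -> segment_in (edisk c r) c x.
Proof.
rewrite /edisk /= => cx t /andP[t0 t1] /=; apply: le_trans cx.
rewrite /eucl_dist /= ler_wsqrtr// {1 2}/GRing.scale/=.
rewrite (_ : c.1 - _ = t * (c.1 - x.1)); last by ring.
rewrite (_ : c.2 - _ = t * (c.2 - x.2)); last by ring.
rewrite !exprMn -mulrDr ler_piMl ?addr_ge0 ?sqr_ge0//.
by rewrite expr_le1.
Qed.

(* The last clause is Taylor's formula for the inverse of [phi] at [phi x], with
   [w] the derivative in the direction [v]: the part of the displacement along [u]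
   is treated as an error. *)
Definition controlled_map (phi : R * R -> R * R) (F : set (R * R)) (L e : R) : Prop :=
  [/\ forall c d, 0 < d -> edisk c d `<=` F -> phi @` edisk c d `<=` edisk (phi c) (L * d),
      forall c d, 0 < d -> edisk c d `<=` F -> edisk (phi c) (L^-1 * d) `<=` phi @` edisk c d,
      forall x y, F x -> F y -> `|x - y| <= L * `|phi x - phi y|,
      forall x y, F x -> F y -> `|phi x - phi y| <= L &
      forall x (u v : R * R), F x -> `|u| <= 1 -> `|v| <= 1 -> exists2 w : R * R, `|w| <= L &
        forall y (a b : R), F y -> phi y - phi x = a *: u + b *: v ->
          `|phi y - phi x| <= e ->
          `|y - x - b *: w| <= L * (`|a| + `|phi y - phi x| ^+ 2)].

(** The inverse [psi] is controlled on a compact thickening [K] of the image of [F] inside [V],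
    where its first and second partial derivatives are bounded. A segment of length at most [e] that
    starts in the image of [F] stays in [K]; pairs of points further apart are handled by the
    boundedness of [F]. *)
Lemma C2_diffeomorphism_controlled (U V F : set (R * R)) phi :
  open V -> C2_diffeomorphism U V phi -> compact F -> F `<=` U ->
  exists L e : R, [/\ 1 <= L, 0 < e & controlled_map phi F L e].
Proof.
move=> oV [psi [[phiUV _] [psiK phiK] phiC2 psiC2]] cF FU.
have C21 (W : set (R * R)) f : class_C 2 W f -> class_C 1 W f.
  move=> [df Df]; split => // v x Wx; apply: differentiable_continuous.
  by have [h _] := Df v; exact: h.
have phic x : F x -> {for x, continuous phi}.
  by move=> /FU; case: phiC2 => + _ => /[apply]; exact: differentiable_continuous.
have cphiF : compact (phi @` F).
  by apply: continuous_compact cF; apply: continuous_in_subspaceT => x; rewrite inE => /phic.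
have phiFV : phi @` F `<=` V by move=> _ [x /FU/phiUV Vx <-].
have [e e0 KV] := thickening_sub_open cphiF oV phiFV.
set K := thickening _ _ in KV.
have cK : compact K by exact: compact_thickening.
have [M1 FM1] := compact_continuous_bounded cF (f := id) (fun x _ => cvg_id).
have [M2 phiM2] := compact_continuous_bounded cF phic.
have [M3 phid3] := class_C1_bounds (C21 _ _ phiC2) cF FU.
have [M4 psid4] := class_C1_bounds (C21 _ _ psiC2) cK KV.
have [M5 psid5] := class_C1_bounds (psiC2.2 (1, 0)) cK KV.
have [M6 psid6] := class_C1_bounds (psiC2.2 (0, 1)) cK KV.
have [M [M1M M2M M3M [M4M M5M M6M] M1']] : exists M : R,
    [/\ M1 <= M, M2 <= M, M3 <= M, [/\ M4 <= M, M5 <= M & M6 <= M] & 1 <= M].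
  exists (\big[Num.max/1]_(N <- [:: M1; M2; M3; M4; M5; M6]) N).
  by rewrite unlock /= !le_max !lexx !orbT.
have M0 : 0 < M by apply: lt_le_trans M1'.
have FM x : F x -> `|x| <= M by move=> /FM1 /le_trans; exact.
have phiM x : F x -> `|phi x| <= M by move=> /phiM2 /le_trans; exact.
have phid := partials_bounded_le M3M phid3.
have psid := partials_bounded_le M4M psid4.
have psid1 := partials_bounded_le M5M psid5.
have psid2 := partials_bounded_le M6M psid6.
have sK x y : F x -> `|y - phi x| <= e -> segment_in K (phi x) y.
  move=> Fx ye t /andP[t0 t1]; exists (phi x); first by exists x.
  rewrite [phi x + _]addrC addrK normrZ ger0_norm//.
  by apply: le_trans ye; rewrite ler_piMl.
have psiphi x : F x -> psi (phi x) = x by move=> /FU; exact: psiK.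
have Me : 0 < 2 * M / e by rewrite divr_gt0 ?mulr_gt0.
(* The term [4 * M] dominates the Lipschitz and Taylor constants; [2 * M / e] gives
   [2 * M <= L * e], which settles points of [F] whose images are more than [e] apart. *)
exists (4 * M + 2 * M / e), e; split => //; first lra.
set L := 4 * M + 2 * M / e; have L0 : 0 < L by rewrite /L; lra.
have ML : 4 * M <= L by rewrite /L; lra.
have MeL : 2 * M <= L * e.
  rewrite /L [leRHS]mulrDl divfK ?gt_eqF//; have : 0 < M * e by rewrite mulr_gt0.
  lra.
split.
- move=> c d d0 cF' _ [x cx <-]; apply: eucl_dist_le.
  have := partials_bounded_lipschitz phid (fun t t01 => cF' _ (segment_in_edisk cx t01)).
  have := norm_le_eucl_dist c x; move: cx; rewrite /edisk/= => cx.
  have := ler_wpM2l (ltW d0) ML.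
  move=> h1 h2 h3; have := ler_wpM2l (ltW M0) (le_trans h2 cx).
  lra.
- move=> c d d0 dF y.
  have Fc : F c by apply: dF; rewrite /edisk/= eucl_dist_le// subrr normr0 mulr0 ltW.
  (* A disk in the bounded set [F] has bounded radius, so [L^-1 * d] is at most [e] and the small
     disk about [phi c] stays in [K]. *)
  have dM : d <= 2 * M.
    have Fcd : F (c + (d, 0)).
      apply: dF; rewrite /edisk/= /eucl_dist/= addr0 subrr expr0n/= addr0 opprD addrA subrr
        sub0r.
      by rewrite sqrrN sqrtr_sqr ger0_norm// ltW.
    have h0 : d <= `|(d, 0 : R)| by rewrite -[leLHS](gtr0_norm d0); exact: (norm_fst (d, 0)).
    have h1 := FM _ Fc; have h2 := FM _ Fcd.
    have h3 : `|(d, 0 : R)| <= `|c + (d, 0)| + `|c|.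
      by have := ler_normB (c + (d, 0)) c; rewrite [c + (d, 0)]addrC addrK.
    lra.
  have Ld : L^-1 * d <= e.
    by rewrite ler_pdivrMl//; lra.
  rewrite /edisk/= => yd; have yL := le_trans (norm_le_eucl_dist _ _) yd.
  have sKy := sK _ _ Fc (le_trans yL Ld).
  exists (psi y); last first.
    by apply: phiK; apply: KV; have := sKy 1; rewrite scale1r addrC subrK; apply; rewrite
      ler01 lexx.
  have := partials_bounded_lipschitz psid sKy; rewrite psiphi// => h.
  apply: eucl_dist_le; have : M * `|y - phi c| <= M * (L^-1 * d) by rewrite ler_pM2l.
  have : 4 * M * (L^-1 * d) <= d by rewrite mulrCA ler_pdivrMl// ler_pM2r.
  lra.
- move=> x y Fx Fy; have [xye|exy] := leP `|phi x - phi y| e.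
    have := partials_bounded_lipschitz psid (sK _ _ Fy xye); rewrite !psiphi//.
    move=> /le_trans; apply; apply: ler_wpM2r => //; lra.
  have h : `|x - y| <= 2 * M.
    by have := ler_normB x y; have := FM _ Fx; have := FM _ Fy; lra.
  apply: le_trans h _; apply: le_trans MeL _; apply: ler_wpM2l; exact: ltW.
- move=> x y Fx Fy; have := ler_normB (phi x) (phi y).
  by have := phiM _ Fx; have := phiM _ Fy; lra.
- move=> x u v Fx u1 v1; have Kx : K (phi x).
    by exists (phi x); [exists x|rewrite subrr normr0 ltW].
  have Dle z : `|z| <= 1 -> `|'D_z psi (phi x)| <= 2 * M.
    move=> z1; apply: le_trans (partials_bounded_derive z psid Kx) _.
    by rewrite ler_piMr// mulr_ge0// ltW.
  exists ('D_v psi (phi x)); first by apply: le_trans (Dle _ v1) _; lra.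
  move=> y a b Fy yab yxe; have := taylor2 psid psid1 psid2 (sK _ _ Fx yxe).
  rewrite !psiphi//; have [dpsi _ _] := psid _ Kx.
  have -> : 'D_(phi y - phi x) psi (phi x) = a *: 'D_u psi (phi x) + b *: 'D_v psi (phi x).
    by rewrite yab !deriveE// linearD !linearZ.
  move=> T.
  apply: le_trans (norm_sub_summand T) _.
  have h1 : `|a *: 'D_u psi (phi x)| <= `|a| * (2 * M).
    by rewrite normrZ; apply: ler_wpM2l => //; exact: Dle.
  have h2 : `|a| * (4 * M) <= `|a| * L by apply: ler_wpM2l.
  have h3 : `|phi y - phi x| ^+ 2 * (4 * M) <= `|phi y - phi x| ^+ 2 * L by apply: ler_wpM2l.
  have h4 : 0 <= `|a| * M by rewrite mulr_ge0// ltW.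
  lra.
Qed.
End Control.

(** * Disks and rectangles *)

Section Planar.
Context {R : realType}.
Implicit Types (x y h c p u : R * R) (E X : set (R * R)) (s : seq (R * R)).

(** All counting is done with duplicate-free lists; this translates the cardinality of the
    definition into them. *)
Lemma card_le_II_uniq (T : choiceType) (S : set T) (n : nat) :
  (S #<= `I_n)%card <->
  forall s : seq T, uniq s -> (forall c : T, c \in s -> S c) -> (size s <= n)%N.
Proof.
split=> [Sn s us sS|H].
  have fS : finite_set S by apply: card_le_finite Sn (finite_II n).
  apply: leq_trans (geq_card_fset_set Sn); apply: uniq_leq_size => // c cs.
  by rewrite in_fset_set// inE; exact: sS.
have fS : finite_set S.
  apply: contrapT => /(@infinite_set_fset _ _ n.+1)[B BS].
  by rewrite leqNgt ltnS H// => c cB; exact: BS.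
have /finite_setP[m Sm] := fS.
rewrite (card_le_eql Sm) card_le_II -(card_fset_set Sm) H// => c.
by rewrite in_fset_set// inE.
Qed.

Definition bounded_overlap (C d : R) E : Prop :=
  forall y s, uniq s -> (forall c, c \in s -> E c /\ edisk c d y) -> (size s)%:R <= C.

Lemma is_ball_unionP (C d : R) A : is_ball_union C d A <->
  exists E, [/\ E !=set0, A = \bigcup_(c in E) edisk c d & bounded_overlap C d E].
Proof.
split=> -[E [E0 AE ov]]; exists E; split => //.
  move=> y s us sE; have [n nC /card_le_II_uniq cn] := ov y.
  by apply: le_trans nC; rewrite ler_nat; exact: cn.
have C0 : 0 <= C by have [x _] := E0; exact: (ov x [::]).
(* A natural number bounded by the real [C] is bounded by its integer part. *)
move=> y; exists (Num.truncn C); first by rewrite truncn_le.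
apply/card_le_II_uniq => s us sE; rewrite -ltnS -(ltr_nat R).
by apply: le_lt_trans (truncnS_gt C); exact: ov us sE.
Qed.

Lemma edisk_box c (d : R) : edisk c d `<=` box c d.
Proof. by move=> y; apply: le_trans (norm_le_eucl_dist _ _). Qed.

Lemma box_edisk c (d : R) : box c (d / 2) `<=` edisk c d.
Proof. by move=> y; rewrite /box/= => yd; apply: eucl_dist_le; lra. Qed.

(** The squares [box c (d / 2)] have area [d ^+ 2], lie in the disks and inherit their overlap
    bound, so [packing] applies. This is the passage from areas to numbers of centres. *)
Lemma packing_bound (C d v : R) E X s : 0 < d -> 0 <= C -> bounded_overlap C d E ->
  uniq s -> (forall c, c \in s -> E c) -> (forall c, c \in s -> edisk c d `<=` X) ->
  (area X <= v%:E)%E -> (size s)%:R * d ^+ 2 <= C * v.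
Proof.
move=> d0 C0 ov us sE sX Xv.
have cnt y : (count (fun c => `|y - c| <= d / 2)%R s <= Num.truncn C)%N.
  rewrite -size_filter -ltnS -(ltr_nat R); apply: le_lt_trans (truncnS_gt C).
  apply: (ov y); first exact: filter_uniq.
  by move=> c; rewrite mem_filter => /andP[yc cs]; split; [exact: sE|exact: box_edisk].
have := packing (ltW (divr_gt0 d0 (ltr0n R 2))) cnt.
set W := \big[setU/set0]_(c <- s) _.
have WX : W `<=` X.
  by rewrite /W -bigcup_seq => y [c /= cs yc]; apply: (sX c cs); exact: box_edisk.
have -> : 4 * (d / 2) ^+ 2 = d ^+ 2 by field.
move=> H; rewrite -lee_fin EFinM; apply: le_trans H _; rewrite EFinM.
have W0 : (0 <= area W)%E by exact: measure_ge0.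
apply: (@le_trans _ _ (C%:E * area W)%E).
  by apply: lee_wpmul2r => //; rewrite lee_fin truncn_le.
apply: lee_wpmul2l; first by rewrite lee_fin.
exact: le_trans (le_area WX) Xv.
Qed.

Lemma scaleRE (a b : R) : a *: b = a * b. Proof. by []. Qed.

Definition dot x y : R := x.1 * y.1 + x.2 * y.2.

Definition perp u : R * R := (- u.2, u.1).

Lemma unit_sqr u : eucl_dist u 0 = 1 -> u.1 ^+ 2 + u.2 ^+ 2 = 1.
Proof.
rewrite /eucl_dist /= !subr0 => u1.
by rewrite -[LHS]sqr_sqrtr ?u1 ?expr1n// addr_ge0 ?sqr_ge0.
Qed.

Lemma unit_norm u : eucl_dist u 0 = 1 -> `|u| <= 1.
Proof.
by move=> <-; have := norm_le_eucl_dist u 0; rewrite sub0r normrN.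
Qed.

Lemma unit_perp u : eucl_dist u 0 = 1 -> eucl_dist (perp u) 0 = 1.
Proof. by rewrite /eucl_dist /= !subr0 sqrrN addrC. Qed.

Lemma dot_norm u x : eucl_dist u 0 = 1 -> `|dot x u| <= 2 * `|x|.
Proof.
move=> /unit_norm u1; apply: le_trans (ler_normD _ _) _; rewrite !normrM.
have -> : 2 * `|x| = 2 * `|x| * 1 by rewrite mulr1.
rewrite [X in X + _]mulrC [X in _ + X]mulrC.
apply: sum2_mul_le; apply/andP; split=> //;
  [exact: le_trans (norm_fst u) u1|exact: le_trans (norm_snd u) u1|exact: norm_fst|exact:
    norm_snd].
Qed.

Lemma dot_perp u x : eucl_dist u 0 = 1 -> x = dot x u *: u + dot x (perp u) *: perp u.
Proof.
move=> /unit_sqr u1; case: x => a b; rewrite /dot /perp /=.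
by congr pair; rewrite /= !scaleRE -[LHS]mulr1 -u1; ring.
Qed.

Lemma dot_combination u (a b : R) : eucl_dist u 0 = 1 ->
  dot (a *: u + b *: perp u) u = a /\ dot (a *: u + b *: perp u) (perp u) = b.
Proof.
move=> /unit_sqr u1; rewrite /dot /perp /= !scaleRE; split.
  by rewrite -[RHS]mulr1 -u1; ring.
by rewrite -[RHS]mulr1 -u1; ring.
Qed.

Lemma rectangleP p u (r1 r2 : R) x : eucl_dist u 0 = 1 ->
  rectangle p u r1 r2 x <-> 0 <= dot (x - p) u <= r1 /\ 0 <= dot (x - p) (perp u) <= r2.
Proof.
move=> u1; split=> [[a [b [ar br ->]]]|[ar br]].
  have -> : p + a *: u + b *: (- u.2, u.1) - p = a *: u + b *: perp u.
    by rewrite -[p + _ + _]addrA [p + _]addrC addrK.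
  by have [-> ->] := dot_combination a b u1.
exists (dot (x - p) u), (dot (x - p) (perp u)); split => //.
by rewrite -addrA -(dot_perp (x - p) u1) addrC subrK.
Qed.

Lemma dotB x y u : dot (x - y) u = dot x u - dot y u.
Proof. by rewrite /dot /=; ring. Qed.

Lemma dotD x y u : dot (x + y) u = dot x u + dot y u.
Proof. by rewrite /dot /=; ring. Qed.

Lemma dotZ (a : R) x u : dot (a *: x) u = a * dot x u.
Proof. by rewrite /dot /= !scaleRE; ring. Qed.

Lemma dot_unit u : eucl_dist u 0 = 1 -> [/\ dot u u = 1, dot (perp u) (perp u) = 1,
  dot u (perp u) = 0 & dot (perp u) u = 0].
Proof.
move=> /unit_sqr u1; rewrite /dot /perp /=; split; rewrite -?u1; ring.
Qed.

(** Squares of half-side [2 * r1] are placed at steps [r1] along the second side, about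
    [r2 / r1 + 1] of them. The term [r1 + r2] also covers the case where [r2] is smaller than
    [r1]. *)
Lemma box_coverable_rectangle p u (r1 r2 : R) : eucl_dist u 0 = 1 ->
  0 < r1 -> 0 <= r2 -> box_coverable (rectangle p u r1 r2) (16 * (r1 * (r1 + r2))).
Proof.
move=> u1 r10 r20; set N := (Num.truncn (r2 / r1)).+1.
pose F j := box (p + (j%:R * r1) *: perp u) (2 * r1).
have := @box_coverable_bigcup R nat (iota 0 N) F (4 * (2 * r1) ^+ 2).
have r1' : 0 <= 2 * r1 by lra.
move=> /(_ (fun _ _ => box_coverable_box _ r1')).
apply: box_coverable_sub.
  move=> x /(rectangleP _ _ _ _ u1)[/andP[a0 ar] /andP[b0 br]].
  rewrite -bigcup_seq; set b := dot (x - p) (perp u) in b0 br.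
  have jb : (Num.truncn (b / r1))%:R * r1 <= b < ((Num.truncn (b / r1))%:R + 1) * r1.
    rewrite -ler_pdivlMr// -ltr_pdivrMr// natr1 truncn_le truncnS_gt.
    by rewrite divr_ge0// ltW.
  have jN : Num.truncn (b / r1) \in iota 0 N.
    by rewrite mem_iota add0n /N ltnS/= le_truncn// ler_pM2r ?invr_gt0.
  exists (Num.truncn (b / r1)) => //.
  move: jb; set j := (Num.truncn _)%:R => /andP[jb1 jb2].
  rewrite /F /box /=.
  have -> : x - (p + (j * r1) *: perp u) = dot (x - p) u *: u + (b - j * r1) *: perp u.
    by rewrite opprD addrA {1}(dot_perp (x - p) u1) -addrA -scalerBl.
  apply: le_trans (norm_combination_le _ _ _ _) _.
  have -> : 2 * r1 = 2 * 1 * r1 by rewrite mulr1.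
  apply: sum2_mul_le; rewrite ?normr_ge0 ?unit_norm ?unit_perp//= ger0_norm//; lra.
rewrite size_iota.
have : N%:R * (4 * (2 * r1) ^+ 2) <= (r2 / r1 + 1) * (4 * (2 * r1) ^+ 2).
  rewrite ler_pM2r ?mulr_gt0 ?exprn_gt0 ?mulr_gt0//.
  by rewrite /N -natr1 lerD2r truncn_le divr_ge0// ltW.
move=> /le_trans; apply; rewrite le_eqVlt; apply/orP; left; apply/eqP.
by field; rewrite gt_eqF.
Qed.

(** The second side of a rectangle runs along [perp u], hence this form. For [w = 0] any unit vector
    serves, with [m = 0]. *)
Lemma unit_direction (w : R * R) : exists u (m : R), eucl_dist u 0 = 1 /\ w = m *: perp u.
Proof.
have [->|w0] := eqVneq w 0.
  exists (1, 0), 0; rewrite scale0r; split => //.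
  by rewrite /eucl_dist/= !subr0 expr1n expr0n addr0 sqrtr1.
pose m := Num.sqrt (w.1 ^+ 2 + w.2 ^+ 2).
have m0 : 0 < m.
  rewrite sqrtr_gt0 lt_def addr_ge0 ?sqr_ge0// andbT paddr_eq0 ?sqr_ge0//.
  apply: contra w0; rewrite !sqrf_eq0 => /andP[/eqP w1 /eqP w2].
  by apply/eqP; case: w w1 w2 {m} => /= ? ? -> ->.
have mm : m ^+ 2 = w.1 ^+ 2 + w.2 ^+ 2 by rewrite sqr_sqrtr// addr_ge0 ?sqr_ge0.
exists (w.2 / m, - w.1 / m), m; split.
  rewrite /eucl_dist/= !subr0 !exprMn sqrrN -mulrDl addrC -mm exprVn divff ?sqrtr1//.
  by rewrite expf_neq0// gt_eqF.
rewrite /perp; case: (w) => a b /=.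
by congr pair; rewrite /= !scaleRE; field; rewrite gt_eqF.
Qed.

(** The points lie within [h] of a segment through [c] along [w], so the second side is put along
    [w]. The factor 4 accounts for both signs and for the factor 2 in [dot_norm]. *)
Lemma rectangle_around c (w : R * R) (g h : R) :
  exists p u, eucl_dist u 0 = 1 /\
    forall x (b : R), `|b *: w| <= g -> `|x - c - b *: w| <= h ->
      rectangle p u (4 * h) (4 * (g + h)) x.
Proof.
have [u [m [u1 wm]]] := unit_direction w.
exists (c - (2 * h) *: u - (2 * (g + h)) *: perp u), u; split => // x b bg xh.
have [uu rr ur ru] := dot_unit u1.
have bg2 : `|b * m| <= 2 * g.
  have := dot_norm (b *: w) (unit_perp u1); rewrite wm scalerA dotZ rr mulr1 => /le_trans;
    apply.
  by rewrite -scalerA -wm; lra.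
have k1 := dot_norm (x - c - b *: w) u1; have k2 := dot_norm (x - c - b *: w) (unit_perp u1).
have e1 : dot (x - c - b *: w) u = dot (x - c) u by rewrite wm scalerA [LHS]dotB dotZ ru
  mulr0 subr0.
have e2 : dot (x - c - b *: w) (perp u) = dot (x - c) (perp u) - b * m.
  by rewrite wm scalerA [LHS]dotB dotZ rr mulr1.
rewrite e1 in k1; rewrite e2 in k2.
have {}k1 : `|dot (x - c) u| <= 2 * h by apply: le_trans k1 _; lra.
have {}k2 : `|dot (x - c) (perp u) - b * m| <= 2 * h by apply: le_trans k2 _; lra.
apply/(rectangleP _ _ _ _ u1); rewrite 2!opprB.
rewrite (_ : x + _ = (x - c) + (2 * h) *: u + (2 * (g + h)) *: perp u); last first.
  by rewrite [_ *: perp u + _]addrC !addrA [x + _ - c]addrAC.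
move: (x - c) k1 k2 => z k1 k2; rewrite !dotD !dotZ uu rr ur ru.
move: k1 k2 bg2; rewrite !ler_norml => /andP[? ?] /andP[? ?] /andP[? ?].
by split; apply/andP; split; lra.
Qed.
End Planar.

(** * Identities and inequalities for real powers *)

Section PowR.
Context {R : realType}.
Implicit Types (r s k : R).

Lemma powR_split r k : 0 < r -> r `^ k * r `^ (1 - k) = r.
Proof.
move=> r0; rewrite -powRD; last by rewrite [X in _ ==> ~~ X]gt_eqF ?implybT.
by rewrite addrC subrK powRr1// ltW.
Qed.

Lemma powR_ge_left r s k : 0 < r -> r <= s -> k <= 1 -> r <= r `^ k * s `^ (1 - k).
Proof.
move=> r0 rs k1; rewrite -{1}(powR_split k r0) ler_wpM2l ?powR_ge0//.
by apply: ge0_ler_powR; rewrite ?subr_ge0 ?nnegrE ?(ltW r0)// (le_trans (ltW r0)).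
Qed.

Lemma powR_le_base1 r k : 1 <= r -> k <= 1 -> r `^ k <= r.
Proof. by move=> r1 k1; rewrite -[leRHS]powRr1 ?(le_trans ler01)// ler_powR. Qed.

Lemma powR_mul_scale k (q r s : R) : 0 < q -> 0 <= r -> 0 <= s ->
  (q * r) `^ k * (q * s) `^ (1 - k) = q * (r `^ k * s `^ (1 - k)).
Proof.
by move=> q0 r0 s0; rewrite !powRM ?(ltW q0)// mulrACA powR_split.
Qed.

(** Divided by [s], the two sides are the powers [k] and [k / 2] of [r / s], which is at most 1. *)
Lemma powR_halve k r s : 0 < r -> r <= s -> 0 <= k ->
  r `^ k * s `^ (1 - k) <= r `^ (k / 2) * s `^ (1 - k / 2).
Proof.
move=> r0 rs k0; have s0 := lt_le_trans r0 rs.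
have -> : r `^ k = r `^ (k / 2) * r `^ (k / 2).
  by rewrite -powRD -?splitr//; rewrite [X in _ ==> ~~ X]gt_eqF ?implybT.
have -> : s `^ (1 - k / 2) = s `^ (k / 2) * s `^ (1 - k).
  rewrite -powRD; last by rewrite [X in _ ==> ~~ X]gt_eqF ?implybT.
  by congr (_ `^ _); rewrite [in RHS]addrCA; lra.
rewrite -mulrA ler_wpM2l ?powR_ge0// ler_wpM2r ?powR_ge0//.
by apply: ge0_ler_powR; rewrite ?nnegrE ?divr_ge0// ltW.
Qed.

(** Cutting into pieces of length [Num.sqrt r] costs one inverse of this length per unit length; the
    exponents add up to [- 1/2 + k + (1 - k)/2 = k/2]. The exponent is halved here. *)
Lemma powR_sqrt_pieces k r : 0 < r ->
  (Num.sqrt r)^-1 * (r `^ k * Num.sqrt r `^ (1 - k)) = r `^ (k / 2).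
Proof.
move=> r0; have s0 : 0 < Num.sqrt r by rewrite sqrtr_gt0.
rewrite -[X in X^-1 * _](powR_split k s0) invfM mulrC -!mulrA.
rewrite [X in _ * X](_ : _ = (Num.sqrt r `^ k)^-1); last first.
  by field; rewrite !gt_eqF ?powR_gt0.
rewrite -powR12_sqrt ?(ltW r0)// -powRrM -powRN -powRD; last by rewrite (gt_eqF r0) implybT.
by congr (_ `^ _); field.
Qed.
End PowR.

Lemma size_le_sum_count (T : eqType) (P : nat -> pred T) (N : nat) (s : seq T) :
  (forall x, x \in s -> exists2 j, (j < N)%N & P j x) ->
  (size s <= \sum_(j < N) count (P j) s)%N.
Proof.
elim: s => [//|x s IH] h /=; rewrite big_split/= -add1n leq_add//.
  have [j jN Pjx] := h x (mem_head _ _).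
  by rewrite (bigD1 (Ordinal jN))//= Pjx.
by apply: IH => z zs; apply: h; rewrite in_cons zs orbT.
Qed.

Lemma rectangle_sub (R : realType) (p u : R * R) (a b a' b' : R) :
  a <= a' -> b <= b' -> rectangle p u a b `<=` rectangle p u a' b'.
Proof.
move=> aa bb x [v [w [/andP[v0 va] /andP[w0 wb] ->]]].
by exists v, w; split=> //; rewrite ?v0 ?w0/= ?(le_trans va)// (le_trans wb).
Qed.

(** * Counting disks in the image *)

Section Counting.
Context {R : realType} (phi : R * R -> R * R) (F : set (R * R)) (L e kappa C t : R).
Context (L1 : 1 <= L) (e0 : 0 < e) (ctl : controlled_map phi F L e).
Context (kappa_gt0 : 0 < kappa) (kappa_le1 : kappa <= 1) (C0 : 0 < C) (t0 : 0 < t).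

(** The images of the centres carry disks of radius [t * d], with [t] to be [L^-1] and [L]. If two
    of these images are within [t * d] of a rectangle with sides at least [d], their coordinates
    differ by at most [k] times the side. *)
Let k := 1 + 4 * t.

(** Comes from [rectangle_around] with [g = L * k * s], [h = q * r] and [r <= s], where
    [q = L * (k + 4 * k ^+ 2) + 1]. *)
Definition piece_const : R := 4 * (L * k + L * (k + 4 * k ^+ 2) + 1).

(** The image of [F] has diameter at most [L], and [d <= L ^+ 2]; so for two points within [t * d]
    of images of centres, any coordinate differs by at most half of this number. *)
Definition image_diam : R := 4 * (L + 2 * t * L ^+ 2).

(** For [r] below this width, [s = Num.sqrt r] satisfies [r <= s] and [2 * k * s <= e], the range in
    which Taylor's formula is available. *)
Definition small_width : R := Num.min 1 ((e / (2 * k)) ^+ 2).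

Definition count_const : R :=
  2 * C ^+ 2 * piece_const * image_diam + C / small_width.

Context (d : R) (E : set (R * R)) (alpha : R).
Context (d0 : 0 < d) (EF : forall c, E c -> edisk c d `<=` F) (ov : bounded_overlap C d E).

Let A := \bigcup_(c in E) edisk c d.

Context (A_alpha : area A = alpha%:E).
Context (A_rectangle : forall p u (r1 r2 : R), eucl_dist u 0 = 1 -> 0 < r1 -> r1 <= r2 ->
    (area (A `&` rectangle p u r1 r2) <=
       (C * r1 `^ kappa * r2 `^ (1 - kappa))%:E * area A)%E).

(** Contains every centre [c] for which the disk of radius [t * d] about [phi c] meets [S]; the sup
    norm is used for convenience. *)
Definition hits (S : set (R * R)) (c : R * R) : Prop :=
  E c /\ exists2 y, S y & `|phi c - y| <= t * d.

Let L0 : 0 < L. Proof. exact: lt_le_trans L1. Qed.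

Let k1 : 1 <= k. Proof. by rewrite /k lerDl mulr_ge0// ltW. Qed.

Let k0 : 0 < k. Proof. exact: lt_le_trans k1. Qed.

Lemma piece_const_gt0 : 0 < piece_const.
Proof.
have h1 := mulr_gt0 L0 k0; have h2 : 0 < L * k ^+ 2 by rewrite mulr_gt0 ?exprn_gt0.
rewrite /piece_const; lra.
Qed.

Lemma alpha_ge0 : 0 <= alpha.
Proof. by rewrite -lee_fin -A_alpha; exact: measure_ge0. Qed.

Lemma centre_in c : E c -> F c.
Proof. by move=> Ec; apply: (EF Ec); rewrite /edisk/= eucl_dist_le// subrr normr0 mulr0
  ltW. Qed.

Lemma hits_sub (S S' : set (R * R)) : S `<=` S' -> hits S `<=` hits S'.
Proof. by move=> SS c [Ec [y Sy cy]]; split => //; exists y => //; exact: SS. Qed.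

Lemma count_hits_trivial (cs : seq (R * R)) : uniq cs -> (forall c : R * R, c \in cs -> E c) ->
  (size cs)%:R * d ^+ 2 <= C * alpha.
Proof.
move=> us csE; apply: (packing_bound (X := A) d0 (ltW C0) ov us csE); last by rewrite A_alpha.
by move=> c cs' y cy; exists c => //; exact: csE.
Qed.

Lemma dot_hits (v y y' c c' : R * R) : eucl_dist v 0 = 1 ->
  `|phi c - y| <= t * d -> `|phi c' - y'| <= t * d ->
  `|dot (phi c - phi c') v - dot (y - y') v| <= 4 * (t * d).
Proof.
move=> v1 h h'; rewrite -dotB.
have -> : phi c - phi c' - (y - y') = (phi c - y) - (phi c' - y').
  by rewrite [X in _ + X]opprD [X in _ = _ + X]opprD addrACA.
have := dot_norm (phi c - y - (phi c' - y')) v1; have := ler_normB (phi c - y) (phi c' - y').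
lra.
Qed.

(** Fix one centre [c0] of the list. Taylor's formula for the inverse at [phi c0] places all the
    disks of the list in a single rectangle with sides [piece_const * r] and [piece_const * s], and
    the rectangle condition on [A] bounds their number. *)
Lemma count_hits_piece p u (r s : R) (cs : seq (R * R)) :
  eucl_dist u 0 = 1 -> d <= r -> r <= s -> s ^+ 2 <= r -> 2 * k * s <= e ->
  uniq cs -> (forall c : R * R, c \in cs -> hits (rectangle p u r s) c) ->
  (size cs)%:R * d ^+ 2 <= C ^+ 2 * piece_const * (r `^ kappa * s `^ (1 - kappa)) * alpha.
Proof.
move=> u1 dr rs s2r kse us csh.
have r0 : 0 < r by apply: lt_le_trans dr.
have s0 : 0 < s by apply: lt_le_trans rs.
have Q0 := piece_const_gt0.
have [->|[c0 c0cs]] : cs = [::] \/ exists c : R * R, c \in cs.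
  by case: (cs) => [|c l]; [left|right; exists c; rewrite mem_head].
  rewrite mul0r; apply: mulr_ge0 alpha_ge0; apply: mulr_ge0; last by rewrite mulr_ge0 ?powR_ge0.
  by apply: mulr_ge0 (ltW Q0); exact: sqr_ge0.
have [Ec0 [y0 Sy0 cy0]] := csh _ c0cs.
have [_ _ _ _ curv] := ctl.
have [w wL hw] := curv _ _ _ (centre_in Ec0) (unit_norm u1) (unit_norm (unit_perp u1)).
set q := L * (k + 4 * k ^+ 2) + 1.
have [p' [u' [u'1 T]]] := rectangle_around c0 w (L * k * s) (q * r).
have q0 : 0 < q.
  have h1 := mulr_gt0 L0 k0; have h2 : 0 < L * k ^+ 2 by rewrite mulr_gt0 ?exprn_gt0.
  rewrite /q; lra.
have Qr0 : 0 < piece_const * r by rewrite mulr_gt0.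
have Qrs : piece_const * r <= piece_const * s by rewrite ler_pM2l.
(* One factor [C] is the overlap of the disks, the other comes from the rectangle condition. *)
have := @packing_bound R C d (C * (piece_const * (r `^ kappa * s `^ (1 - kappa))) * alpha) E
  (A `&` rectangle p' u' (piece_const * r) (piece_const * s)) cs d0 (ltW C0) ov us.
rewrite (_ : C * (C * _ * _) = C ^+ 2 * piece_const * (r `^ kappa * s `^ (1 - kappa)) *
  alpha); last by ring.
apply.
- by move=> c /csh[].
- move=> c /csh[Ec [y Sy cy]] x cx; split; first by exists c.
  have dk : 4 * (t * d) <= 4 * t * r by rewrite mulrA ler_pM2l ?mulr_gt0.
  have [/andP[a0 ar] /andP[b0 bs]] := (rectangleP _ _ _ _ u1).1 Sy.
  have [/andP[a0' ar'] /andP[b0' bs']] := (rectangleP _ _ _ _ u1).1 Sy0.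
  have da := dot_hits u1 cy cy0; have db := dot_hits (unit_perp u1) cy cy0.
  have yy v : dot (y - y0) v = dot (y - p) v - dot (y0 - p) v.
    by rewrite -dotB opprB addrA subrK.
  rewrite yy in da; rewrite yy in db.
  have eqc := dot_perp (phi c - phi c0) u1.
  move: (dot (phi c - phi c0) u) (dot (phi c - phi c0) (perp u)) da db eqc => a b da db eqc.
  have ak : `|a| <= k * r.
    by move: da; rewrite /k !ler_norml => /andP[? ?]; apply/andP; split; lra.
  have bk : `|b| <= k * s.
    have ts : 4 * t * r <= 4 * t * s by rewrite ler_pM2l ?mulr_gt0.
    by move: db; rewrite /k !ler_norml => /andP[? ?]; apply/andP; split; lra.
  have krs : k * r <= k * s by rewrite ler_pM2l.
  have nks : `|phi c - phi c0| <= 2 * k * s.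
    rewrite eqc; apply: le_trans (norm_combination_le _ _ _ _) _.
    rewrite (_ : 2 * k * s = 2 * 1 * (k * s)); last by ring.
    apply: sum2_mul_le; rewrite ?normr_ge0 ?unit_norm ?unit_perp//= ?bk//.
    exact: le_trans krs.
  have := hw c a b (centre_in Ec) eqc (le_trans nks kse) => h.
  (* The quadratic error is of order [s ^+ 2], hence no larger than the order of the width [r]. *)
  have n2 : `|phi c - phi c0| ^+ 2 <= 4 * k ^+ 2 * r.
    have := ler_pM (normr_ge0 _) (normr_ge0 _) nks nks; rewrite -expr2 => /le_trans; apply.
    rewrite (_ : 2 * k * s * (2 * k * s) = 4 * k ^+ 2 * s ^+ 2); last by ring.
    by apply: ler_wpM2l => //; rewrite mulr_ge0// sqr_ge0.
  (* The whole disk about [c] has to fit, not only its centre: this is the summand 1 in [q]. *)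
  have xr : `|x - c| <= r by apply: le_trans dr; exact: edisk_box cx.
  have bw : `|b *: w| <= L * k * s.
    rewrite normrZ mulrC -mulrA; apply: ler_pM => //.
  have xw : `|x - c0 - b *: w| <= q * r.
    rewrite -(subrKA c x) -addrA; apply: le_trans (ler_normD _ _) _.
    have h' : L * (`|a| + `|phi c - phi c0| ^+ 2) <= L * (k * r + 4 * k ^+ 2 * r).
      by rewrite ler_pM2l// lerD.
    move: h; rewrite /q; lra.
  have := T x b bw xw; apply: rectangle_sub.
    have : 0 < L * k * r by rewrite !mulr_gt0.
    by rewrite /piece_const /q; lra.
  have : q * r <= q * s by rewrite ler_pM2l.
  by rewrite /piece_const /q; lra.
- apply: le_trans (A_rectangle _ u'1 Qr0 Qrs) _.
  rewrite A_alpha -EFinM lee_fin -mulrA powR_mul_scale ?(ltW r0) ?(ltW s0)//.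
Qed.

Lemma image_diam_ge1 : 1 <= image_diam.
Proof.
have h : 0 < 2 * t * L ^+ 2 by rewrite !mulr_gt0 ?exprn_gt0.
by rewrite /image_diam; have := L1; lra.
Qed.

Lemma small_width_gt0 : 0 < small_width.
Proof. by rewrite /small_width lt_min ltr01 exprn_gt0// divr_gt0// mulr_gt0. Qed.

(** The disk contains two points of [F] at distance [d]; their images are at distance at most [L],
    and the inverse expands by at most [L]. *)
Lemma radius_le c : E c -> d <= L ^+ 2.
Proof.
move=> Ec; have Fc := centre_in Ec.
have Fcd : F (c + (d, 0)).
  apply: (EF Ec); rewrite /edisk/= /eucl_dist/= addr0 subrr expr0n/= addr0 opprD addrA
    subrr sub0r.
  by rewrite sqrrN sqrtr_sqr ger0_norm// ltW.
have [_ _ lip diam _] := ctl.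
have h1 := lip _ _ Fcd Fc; have h2 := diam _ _ Fcd Fc.
rewrite [c + _]addrC in h1 h2; rewrite addrK in h1.
have h0 : d <= `|(d, 0 : R)| by rewrite -[leLHS](gtr0_norm d0); exact: (norm_fst (d, 0)).
apply: le_trans h0 _; apply: le_trans h1 _; by rewrite expr2 ler_pM2l.
Qed.

Lemma count_hits_strip p u (r r2 : R) (cs : seq (R * R)) :
  eucl_dist u 0 = 1 -> d <= r -> r <= r2 -> r <= small_width -> r2 <= image_diam ->
  uniq cs -> (forall c : R * R, c \in cs -> hits (rectangle p u r r2) c) ->
  (size cs)%:R * d ^+ 2 <=
    2 * C ^+ 2 * piece_const * image_diam * (r `^ (kappa / 2) * r2 `^ (1 - kappa / 2)) * alpha.
Proof.
move=> u1 dr rr2; rewrite /small_width le_min => /andP[r1 re] r2D us csh.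
have r0 : 0 < r by apply: lt_le_trans dr.
have r20 : 0 < r2 by apply: lt_le_trans rr2.
have Q0 := piece_const_gt0; have D1 := image_diam_ge1.
have CQ0 : 0 < C ^+ 2 * piece_const by rewrite mulr_gt0 ?exprn_gt0.
set s := Num.sqrt r; have s0 : 0 < s by rewrite sqrtr_gt0.
have ss : s ^+ 2 = r by rewrite sqr_sqrtr// ltW.
have s1 : s <= 1 by rewrite -sqrtr1 ler_wsqrtr.
have rs : r <= s by rewrite -ss expr2 ler_piMl// ltW.
have se : 2 * k * s <= e.
  have k20 : 0 < 2 * k by rewrite mulr_gt0.
  rewrite mulrC -ler_pdivlMr//.
  have ek : 0 <= e / (2 * k) by rewrite divr_ge0 ?(ltW e0) ?(ltW k20).
  by rewrite -(ger0_norm ek) -sqrtr_sqr ler_wsqrtr.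
set P := r `^ (kappa / 2) * r2 `^ (1 - kappa / 2).
(* A rectangle no longer than [s] is a single piece, and halving the exponent only weakens the
   bound. *)
have [r2s|sr2] := leP r2 s.
  have r2r : r2 ^+ 2 <= r by rewrite -ss ler_sqr ?nnegrE ?(ltW s0) ?(ltW r20).
  have r2e : 2 * k * r2 <= e by apply: le_trans se; rewrite ler_pM2l// mulr_gt0.
  have := count_hits_piece u1 dr rr2 r2r r2e us csh; move=> /le_trans; apply.
  rewrite ler_wpM2r ?alpha_ge0//.
  have P0 : 0 <= P by rewrite mulr_ge0 ?powR_ge0.
  apply: (@le_trans _ _ (C ^+ 2 * piece_const * P)).
    by rewrite ler_pM2l//; apply: powR_halve => //; exact: ltW.
  rewrite (_ : 2 * C ^+ 2 * piece_const * image_diam * P =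
    (C ^+ 2 * piece_const * P) * (2 * image_diam)); last by ring.
  by apply: ler_peMr; [exact: mulr_ge0 (ltW CQ0) P0|lra].
set N := (Num.truncn (r2 / s)).+1.
pose S j := rectangle (p + (j%:R * s) *: perp u) u r s.
pose I j : pred (R * R) := fun c => `[< hits (S j) c >].
set B := C ^+ 2 * piece_const * (r `^ kappa * s `^ (1 - kappa)) * alpha.
have B0 : 0 <= B.
  by apply: mulr_ge0 alpha_ge0; apply: mulr_ge0 (ltW CQ0) _; rewrite mulr_ge0 ?powR_ge0.
have sB j : (count (I j) cs)%:R * d ^+ 2 <= B.
  rewrite -size_filter; apply: (count_hits_piece (p := p + (j%:R * s) *: perp u) u1 dr rs)
    => //; first by rewrite ss.
    exact: filter_uniq.
  by move=> c; rewrite mem_filter => /andP[/asboolP].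
have sum_le : (size cs <= \sum_(j < N) count (I j) cs)%N.
  apply: size_le_sum_count => c /csh[Ec [y Sy cy]].
  have [/andP[a0 ar] /andP[b0 bs]] := (rectangleP _ _ _ _ u1).1 Sy.
  set b := dot (y - p) (perp u) in b0 bs.
  have jb : (Num.truncn (b / s))%:R * s <= b < ((Num.truncn (b / s))%:R + 1) * s.
    rewrite -ler_pdivlMr// -ltr_pdivrMr// natr1 truncn_le truncnS_gt.
    by rewrite divr_ge0// ltW.
  exists (Num.truncn (b / s)).
    by rewrite /N ltnS le_truncn// ler_pM2r ?invr_gt0.
  apply/asboolP; split => //; exists y => //.
  have [uu rr ur ru] := dot_unit u1.
  apply/(rectangleP _ _ _ _ u1); rewrite opprD addrA ![dot (_ - _ *: _) _]dotB !dotZ ru rr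
    mulr0 subr0 mulr1.
  rewrite a0 ar -/b; split=> //; move: jb; set j := (Num.truncn _)%:R => /andP[? ?].
  by apply/andP; split; lra.
have : (size cs)%:R * d ^+ 2 <= N%:R * B.
  apply: (@le_trans _ _ ((\sum_(j < N) count (I j) cs)%:R * d ^+ 2)).
    by rewrite ler_wpM2r ?sqr_ge0// ler_nat.
  rewrite natr_sum mulr_suml mulr_natl -[X in _ *+ X](card_ord N) -sumr_const.
  by apply: ler_sum => j _; exact: sB.
move=> /le_trans; apply.
(* Rounding up at most doubles the number of pieces, since [r2 / s] exceeds 1. *)
have N2 : N%:R <= 2 * r2 / s.
  have : (Num.truncn (r2 / s))%:R <= r2 / s by rewrite truncn_le divr_ge0// ltW.
  have : 1 <= r2 / s by rewrite ler_pdivlMr// mul1r ltW.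
  by rewrite /N -natr1; lra.
apply: (le_trans (ler_wpM2r B0 N2)).
(* The sum over the pieces is linear in [r2]; the boundedness of [r2] absorbs the surplus power
   [kappa / 2]. *)
have r2P : r2 <= image_diam * r2 `^ (1 - kappa / 2).
  rewrite -{1}(powR_split (kappa / 2) r20) ler_wpM2r ?powR_ge0//.
  apply: (@le_trans _ _ (image_diam `^ (kappa / 2))).
    by apply: ge0_ler_powR; rewrite ?nnegrE ?divr_ge0 ?(ltW r20) ?(ltW kappa_gt0)//
      (le_trans ler01).
  by apply: powR_le_base1 => //; have := kappa_le1; have := kappa_gt0; lra.
rewrite (_ : 2 * r2 / s * B = 2 * C ^+ 2 * piece_const * r2 *
   (s^-1 * (r `^ kappa * s `^ (1 - kappa))) * alpha); last by rewrite /B; ring.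
rewrite ler_wpM2r ?alpha_ge0// powR_sqrt_pieces// /P.
rewrite (_ : 2 * C ^+ 2 * piece_const * image_diam * _ =
  2 * (C ^+ 2 * piece_const) * (image_diam * r2 `^ (1 - kappa / 2)) * r `^ (kappa / 2));
    last by ring.
rewrite ler_wpM2r ?powR_ge0// -[2 * C ^+ 2 * _]mulrA ler_pM2l// mulr_gt0//.
Qed.

Lemma count_const_ge0 : 0 <= count_const.
Proof.
have D0 := lt_le_trans ltr01 image_diam_ge1.
have Q0 := piece_const_gt0.
have C2 : 0 < 2 * C ^+ 2 by rewrite mulr_gt0 ?exprn_gt0.
apply: addr_ge0; apply: ltW; first exact: mulr_gt0 (mulr_gt0 C2 Q0) D0.
by apply: divr_gt0 C0 small_width_gt0.
Qed.

Lemma count_hits_rectangle p u (r r2 : R) (cs : seq (R * R)) :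
  eucl_dist u 0 = 1 -> d <= r -> r <= r2 ->
  uniq cs -> (forall c : R * R, c \in cs -> hits (rectangle p u r r2) c) ->
  (size cs)%:R * d ^+ 2 <= count_const * (r `^ (kappa / 2) * r2 `^ (1 - kappa / 2)) * alpha.
Proof.
move=> u1 dr rr2 us csh.
have r0 : 0 < r by apply: lt_le_trans dr.
have r20 : 0 < r2 by apply: lt_le_trans rr2.
have Q0 := piece_const_gt0; have D1 := image_diam_ge1; have D0 := lt_le_trans ltr01 D1.
have w0 := small_width_gt0.
set P := r `^ (kappa / 2) * r2 `^ (1 - kappa / 2).
have P0 : 0 <= P by rewrite mulr_ge0 ?powR_ge0.
have kappa2 : kappa / 2 <= 1 by have := kappa_le1; have := kappa_gt0; lra.
set K1 := 2 * C ^+ 2 * piece_const * image_diam.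
have C2 : 0 < 2 * C ^+ 2 by rewrite mulr_gt0 ?exprn_gt0.
have K10 : 0 < K1 by exact: mulr_gt0 (mulr_gt0 C2 Q0) D0.
have Ks : count_const = K1 + C / small_width by [].
have Cw0 : 0 < C / small_width by rewrite divr_gt0.
(* For a wide rectangle the product of powers is at least [small_width], and counting all centres is
   enough. *)
have [rw|wr] := leP r small_width; last first.
  apply: (le_trans (count_hits_trivial us (fun c cc => (csh c cc).1))).
  rewrite ler_wpM2r ?alpha_ge0//.
  have rP : r <= P by exact: powR_ge_left.
  have : C / small_width * small_width <= C / small_width * P.
    by rewrite ler_pM2l//; apply: le_trans rP; exact: ltW.
  rewrite divfK ?gt_eqF// => /le_trans; apply; rewrite ler_wpM2r// Ks lerDr ltW//.
suff : (size cs)%:R * d ^+ 2 <= K1 * P * alpha.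
  by move=> /le_trans; apply; rewrite ler_wpM2r ?alpha_ge0// ler_wpM2r// Ks lerDl ltW.
have [r2D|Dr2] := leP r2 image_diam.
  exact: (count_hits_strip u1 dr rr2 rw r2D us csh).
have [->|[c0 c0cs]] : cs = [::] \/ exists c : R * R, c \in cs.
  by case: (cs) => [|c l]; [left|right; exists c; rewrite mem_head].
  by rewrite mul0r; apply: mulr_ge0 alpha_ge0; apply: mulr_ge0 (ltW K10) P0.
have [Ec0 [y0 Sy0 cy0]] := csh _ c0cs.
have dL := radius_le Ec0.
pose b0 := dot (y0 - p) (perp u).
have rD : r <= image_diam.
  by apply: le_trans rw _; apply: le_trans D1; rewrite ge_min lexx.
(* A rectangle longer than [image_diam] can be shortened to that length around the level of [y0],
   because the image is bounded. *)
have cs' (c : R * R) : c \in cs ->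
    hits (rectangle (p + (b0 - image_diam / 2) *: perp u) u r image_diam) c.
  move=> /csh[Ec [y Sy cy]]; split => //; exists y => //.
  have [uu rr ur ru] := dot_unit u1.
  have [/andP[a1 ar] /andP[b1 bs]] := (rectangleP _ _ _ _ u1).1 Sy.
  apply/(rectangleP _ _ _ _ u1); rewrite opprD addrA ![dot (_ - _ *: _) _]dotB !dotZ ru rr
    mulr0 subr0 mulr1.
  rewrite a1 ar; split=> //.
  have : `|dot (y - y0) (perp u)| <= image_diam / 2.
    apply: (le_trans (dot_norm _ (unit_perp u1))).
    have [_ _ _ diam _] := ctl.
    have h1 := diam _ _ (centre_in Ec) (centre_in Ec0).
    have h2 : `|y - y0| <= `|phi c - phi c0| + 2 * (t * d).
      have -> : y - y0 = (phi c - phi c0) - ((phi c - y) - (phi c0 - y0)).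
        by rewrite opprB addrA subrKA opprB addrC subrKA.
      apply: (le_trans (ler_normB _ _)); rewrite lerD2l.
      by apply: (le_trans (ler_normB _ _)); rewrite mulr_natl mulr2n lerD.
    have h3 : t * d <= t * L ^+ 2 by rewrite ler_pM2l.
    by rewrite /image_diam; lra.
  have -> : dot (y - y0) (perp u) = dot (y - p) (perp u) - b0.
    by rewrite /b0 -dotB opprB addrA subrK.
  move: b1 bs.
  rewrite ler_norml => ? ? /andP[? ?]; apply/andP; split; lra.
apply: (le_trans (count_hits_strip u1 dr rD rw (lexx _) us cs')).
rewrite ler_wpM2r ?alpha_ge0// ler_pM2l// ler_wpM2l ?powR_ge0//.
by apply: ge0_ler_powR; rewrite ?nnegrE ?subr_ge0 ?(ltW D0) ?(ltW r20)// ltW.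
Qed.

(** * The union of disks about the images: overlap, area and concentration *)

Lemma lift_centres (s : seq (R * R)) : (forall z, z \in s -> (phi @` E) z) ->
  exists2 cs, s = map phi cs & forall c : R * R, c \in cs -> E c.
Proof.
elim: s => [|z s IH] sE; first by exists [::].
have [c Ec cz] := sE z (mem_head _ _).
have [|cs scs csE] := IH; first by move=> y ys; apply: sE; rewrite in_cons ys orbT.
exists (c :: cs); first by rewrite /= cz scs.
by move=> y; rewrite in_cons => /predU1P[->|/csE].
Qed.

Definition overlap_const : R := 4 * C * (2 * L * t + 1) ^+ 2.

(** If disks about images share a point, the images are within [2 * (t * d)] of each other and the
    centres within [L] times that. The original disks then lie in one square about [c0], where
    packing counts them. *)
Lemma image_overlap : bounded_overlap overlap_const (t * d) (phi @` E).
Proof.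
move=> y s us sE; have [|cs scs csE] := @lift_centres s; first by move=> z /sE[].
have ucs : uniq cs by move: us; rewrite scs; exact: map_uniq.
have cy (c : R * R) : c \in cs -> `|y - phi c| <= t * d.
  move=> ccs; have [|_] := sE (phi c); first by rewrite scs map_f.
  by apply: le_trans; exact: norm_le_eucl_dist.
rewrite scs size_map.
have [->|[c0 c0cs]] : cs = [::] \/ exists c : R * R, c \in cs.
  by case: (cs) => [|c l]; [left|right; exists c; rewrite mem_head].
  by rewrite /overlap_const mulr_ge0 ?sqr_ge0// mulr_ge0// ltW.
have d20 : 0 < d ^+ 2 by rewrite exprn_gt0.
rewrite -(ler_pM2r d20) /overlap_const.
rewrite (_ : 4 * C * (2 * L * t + 1) ^+ 2 * d ^+ 2 = C * (4 * ((2 * L * t + 1) * d) ^+ 2));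
  last by ring.
have rad0 : 0 <= (2 * L * t + 1) * d.
  by apply: mulr_ge0 (ltW d0); rewrite addr_ge0// !mulr_ge0 ?(ltW L0) ?(ltW t0).
apply: (packing_bound (X := box c0 ((2 * L * t + 1) * d)) d0 (ltW C0) ov ucs csE).
  move=> c ccs x /edisk_box xc; rewrite /box /= in xc *.
  have [_ _ lip _ _] := ctl.
  have h1 := lip _ _ (centre_in (csE _ ccs)) (centre_in (csE _ c0cs)).
  have h2 : `|phi c - phi c0| <= 2 * (t * d).
    rewrite -(subrKA y); apply: le_trans (ler_normD _ _) _.
    by rewrite [X in X + _]distrC mulr_natl mulr2n lerD ?cy.
  have h3 : L * `|phi c - phi c0| <= L * (2 * (t * d)) by rewrite ler_pM2l.
  have h4 : `|x - c0| <= `|x - c| + `|c - c0| by rewrite -(subrKA c) ler_normD.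
  lra.
by rewrite area_box.
Qed.

Let B := \bigcup_(z in phi @` E) edisk z (t * d).

(** Packing in [A], which has finite area, bounds the number of all centres. *)
Lemma enum_hits (S : set (R * R)) : exists2 cs : seq (R * R), uniq cs &
  forall c : R * R, c \in cs <-> hits S c.
Proof.
have : finite_set (hits S).
  apply: (@card_le_finite _ _ _ `I_(Num.truncn (C * alpha / d ^+ 2))); last exact: finite_II.
  apply/card_le_II_uniq => cs us csh; rewrite -ltnS -(ltr_nat R).
  apply: le_lt_trans (truncnS_gt _); rewrite ler_pdivlMr ?exprn_gt0//.
  by apply: count_hits_trivial us _ => c /csh[].
move=> /finite_seqP[s sE]; exists (undup s); first exact: undup_uniq.
by move=> c; rewrite mem_undup sE.
Qed.

(** At most [K / d ^+ 2] disks reach [S], and the part of each in [S] has a cover of total area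
    [m]. *)
Lemma image_coverable (S : set (R * R)) (K m : R) : 0 <= m ->
  (forall cs : seq (R * R), uniq cs -> (forall c : R * R, c \in cs -> hits S c) ->
    (size cs)%:R * d ^+ 2 <= K) ->
  (forall c, E c -> box_coverable (edisk (phi c) (t * d) `&` S) m) ->
  box_coverable (B `&` S) (K / d ^+ 2 * m).
Proof.
move=> m0 hK hm; have [cs us csh] := enum_hits S.
have := @box_coverable_bigcup R _ cs (fun c => edisk (phi c) (t * d) `&` S) m.
move=> /(_ (fun c cc => hm c ((csh c).1 cc).1)); apply: box_coverable_sub.
  move=> x [[_ [c Ec <-] cx] Sx]; rewrite -bigcup_seq; exists c => //=.
  apply/csh; split => //; exists x => //.
  by rewrite distrC; exact: edisk_box cx.
rewrite ler_wpM2r// ler_pdivlMr ?exprn_gt0//; apply: hK => // c.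
by move/csh.
Qed.

Definition lower_const : R := 4 * overlap_const / t ^+ 2.

(** Both areas are comparable to the number of centres times [d ^+ 2]: from above by covering the
    disks with squares, from below by packing, with overlap [C] for [A] and [overlap_const] for
    [B]. *)
Lemma image_area : exists beta, [/\ area B = beta%:E,
  beta <= 4 * t ^+ 2 * C * alpha & alpha <= lower_const * beta].
Proof.
have d20 : 0 < d ^+ 2 by rewrite exprn_gt0.
have td0 : 0 <= t * d by rewrite mulr_ge0// ltW.
have upper : (area B <= (4 * t ^+ 2 * C * alpha)%:E)%E.
  rewrite -[B]setIT; apply: box_coverable_area.
  rewrite (_ : _ * alpha = C * alpha / d ^+ 2 * (4 * (t * d) ^+ 2)); last first.
    by field; rewrite gt_eqF.
  apply: image_coverable; first by rewrite mulr_ge0 ?sqr_ge0.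
    by move=> cs us csh; apply: count_hits_trivial us _ => c /csh[].
  move=> c _; apply: box_coverable_sub (box_coverable_box (phi c) td0) => //.
  by rewrite setIT; exact: edisk_box.
have B0 : (0 <= area B)%E by exact: measure_ge0.
have Bfin : (area B)%E = (fine (area B))%:E.
  by rewrite fineK// ge0_fin_numE//; apply: le_lt_trans upper _; exact: ltry.
exists (fine (area B)); split => //; first by rewrite -lee_fin -Bfin.
have [cs us csh] := enum_hits setT.
have csE (c : R * R) : c \in cs -> E c by move=> /csh[].
have low : alpha <= (size cs)%:R * (4 * d ^+ 2).
  rewrite -lee_fin -A_alpha; apply: box_coverable_area.
  apply: box_coverable_sub (@box_coverable_bigcup R _ cs (fun c => edisk c d) _ _) => //.
    move=> x [c Ec cx]; rewrite -bigcup_seq; exists c => //=.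
    by apply/csh; split => //; exists (phi c) => //; rewrite subrr normr0.
  move=> c _; apply: box_coverable_sub (box_coverable_box c (ltW d0)) => //.
  exact: edisk_box.
have packB : (size cs)%:R * (t * d) ^+ 2 <= overlap_const * fine (area B).
  rewrite -(size_map phi).
  apply: (packing_bound (X := B) (mulr_gt0 t0 d0) _ image_overlap).
  - by rewrite /overlap_const mulr_ge0 ?sqr_ge0// mulr_ge0// ltW.
  - rewrite map_inj_in_uniq// => c c' /csE Ec /csE Ec' cc'.
    have [_ _ lip _ _] := ctl.
    have := lip _ _ (centre_in Ec) (centre_in Ec'); rewrite cc' subrr normr0 mulr0.
    by rewrite normr_le0 subr_eq0 => /eqP.
  - by move=> _ /mapP[c /csE Ec ->]; exists c.
  - move=> _ /mapP[c /csE Ec ->] x cx; exists (phi c) => //; by exists c.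
  - by rewrite -Bfin.
apply: le_trans low _; rewrite /lower_const.
rewrite (_ : _ * _ = 4 / t ^+ 2 * ((size cs)%:R * (t * d) ^+ 2)); last first.
  by field; rewrite gt_eqF.
rewrite [leRHS](_ : _ = 4 / t ^+ 2 * (overlap_const * fine (area B))); last by ring.
by rewrite ler_wpM2l// divr_ge0// sqr_ge0.
Qed.

(** Only a stretch of length [8 * rho] of the rectangle can meet the disk: points of the disk differ
    by at most [2 * rho] in the sup norm, hence by [4 * rho] in a coordinate, on either side of
    [x0]. *)
Lemma disk_rectangle_coverable (z p u : R * R) (rho r1 r2 : R) : 0 <= rho ->
  eucl_dist u 0 = 1 -> 0 < r1 ->
  box_coverable (edisk z rho `&` rectangle p u r1 r2) (16 * (r1 * (r1 + 8 * rho))).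
Proof.
move=> rho0 u1 r10; have rho80 : 0 <= 8 * rho by rewrite mulr_ge0.
have [[x0 [zx0 Sx0]]|none] := pselect (exists x, (edisk z rho `&` rectangle p u r1 r2) x);
  last first.
  apply: box_coverable_sub (box_coverable_rectangle p u1 r10 rho80) => //.
  by move=> x Sx; exfalso; apply: none; exists x.
pose b0 := dot (x0 - p) (perp u).
apply: box_coverable_sub (box_coverable_rectangle (p + (b0 - 4 * rho) *: perp u) u1 r10
  rho80) => //.
move=> x [zx Sx]; have [uu rr ur ru] := dot_unit u1.
have [/andP[a1 ar] _] := (rectangleP _ _ _ _ u1).1 Sx.
apply/(rectangleP _ _ _ _ u1); rewrite opprD addrA ![dot (_ - _ *: _) _]dotB !dotZ ru rr
  mulr0 subr0 mulr1.
rewrite a1 ar; split => //.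
have h1 : `|x - x0| <= 2 * rho.
  rewrite -(subrKA z); apply: le_trans (ler_normD _ _) _.
  by rewrite [X in _ + X]distrC mulr_natl mulr2n lerD//; apply: edisk_box.
have := dot_norm (x - x0) (unit_perp u1).
have -> : dot (x - x0) (perp u) = dot (x - p) (perp u) - b0.
  by rewrite /b0 -dotB opprB addrA subrK.
move: (dot (x - p) (perp u)) => b h2.
have : `|b - b0| <= 4 * rho by lra.
by rewrite ler_norml => /andP[? ?]; apply/andP; split; lra.
Qed.

(** The summand [32 * C] serves rectangles with [r2 < d], the other one the remaining cases;
    [lower_const] replaces [alpha] by [beta]. *)
Definition rectangle_const : R :=
  (32 * C + 16 * (1 + 8 * t) ^+ 2 * count_const) * lower_const.

Context (alpha_lower : C^-1 * d <= alpha) (alpha_upper : alpha <= C * d).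

Let E_nonempty : E !=set0.
Proof.
apply: contrapT => /set0P/negP; rewrite negbK => /eqP E0.
have : 0 < alpha by apply: lt_le_trans alpha_lower; rewrite mulr_gt0 ?invr_gt0.
have : area A = 0%E by rewrite /A E0 bigcup_set0; exact: measure0.
by rewrite A_alpha => -[->]; rewrite ltxx.
Qed.

Lemma overlap_const_gt0 : 0 < overlap_const.
Proof.
have h : 0 < 2 * L * t + 1 by rewrite ltr_pwDr// !mulr_ge0 ?(ltW L0) ?(ltW t0).
by apply: mulr_gt0 (mulr_gt0 _ C0) (exprn_gt0 _ h).
Qed.

Lemma lower_const_gt0 : 0 < lower_const.
Proof. by rewrite /lower_const divr_gt0 ?exprn_gt0// mulr_gt0// overlap_const_gt0. Qed.

Lemma rectangle_const_gt0 : 0 < rectangle_const.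
Proof.
apply: mulr_gt0 lower_const_gt0; apply: ltr_pwDl; first exact: mulr_gt0.
by apply: mulr_ge0 count_const_ge0; rewrite mulr_ge0 ?sqr_ge0.
Qed.

Lemma image_rectangle (beta : R) p u (r1 r2 : R) : alpha <= lower_const * beta ->
  eucl_dist u 0 = 1 -> 0 < r1 -> r1 <= r2 ->
  (area (B `&` rectangle p u r1 r2) <=
    (rectangle_const * (r1 `^ (kappa / 2) * r2 `^ (1 - kappa / 2)) * beta)%:E)%E.
Proof.
move=> ab u1 r10 r12; have r20 : 0 < r2 by apply: lt_le_trans r12.
have a0 := alpha_ge0.
have kappa2 : kappa / 2 <= 1 by have := kappa_le1; have := kappa_gt0; lra.
have cc0 := count_const_ge0.
set P := r1 `^ (kappa / 2) * r2 `^ (1 - kappa / 2).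
have P0 : 0 <= P by rewrite mulr_ge0 ?powR_ge0.
have r1P : r1 <= P by exact: powR_ge_left.
have d20 : 0 < d ^+ 2 by rewrite exprn_gt0.
have T0 : 0 <= 16 * (1 + 8 * t) ^+ 2 * count_const.
  by apply: mulr_ge0 cc0; rewrite mulr_ge0 ?sqr_ge0.
have final (X : set (R * R)) (v : R) : box_coverable X v ->
    v <= (32 * C + 16 * (1 + 8 * t) ^+ 2 * count_const) * P * alpha ->
    (area X <= (rectangle_const * P * beta)%:E)%E.
  move=> Xv vle; apply: le_trans (box_coverable_area Xv) _; rewrite lee_fin.
  apply: le_trans vle _; rewrite /rectangle_const.
  set T := 32 * C + _; have TP0 : 0 <= T * P.
    by apply: mulr_ge0 P0; rewrite addr_ge0// mulr_ge0// ltW.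
  rewrite (_ : T * lower_const * P * beta = T * P * (lower_const * beta)); last by ring.
  by rewrite ler_wpM2l.
have Pa0 : 0 <= P * alpha by rewrite mulr_ge0.
have C32 : 0 <= 32 * C * (P * alpha) by apply: mulr_ge0 Pa0; rewrite mulr_ge0// ltW.
(* Below the scale [d] the area of the rectangle itself suffices, as [r1 <= P] and
   [r2 < d <= C * alpha]. *)
have [r2d|dr2] := ltP r2 d.
  apply: (final _ (16 * (r1 * (r1 + r2)))).
    by apply: box_coverable_sub (box_coverable_rectangle p u1 r10 (ltW r20)) => // x [].
  have h1 : r1 * (r1 + r2) <= P * (2 * r2).
    by apply: ler_pM => //; rewrite ?addr_ge0 ?(ltW r10) ?(ltW r20)//; lra.
  have h2 : P * r2 <= P * (C * alpha).
    apply: ler_wpM2l => //; apply: (le_trans (ltW r2d)).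
    by rewrite -ler_pdivrMl.
  have h3 := mulr_ge0 T0 Pa0.
  rewrite -mulrA mulrDl; lra.
have td0 : 0 <= t * d by rewrite mulr_ge0// ltW.
have [dr1|r1d] := leP d r1.
  have m0 : 0 <= 4 * (t * d) ^+ 2 by rewrite mulr_ge0 ?sqr_ge0.
  have count cs us csh := @count_hits_rectangle p u r1 r2 cs u1 dr1 r12 us csh.
  apply: (final _ _ (@image_coverable (rectangle p u r1 r2) _ _ m0 count _)).
    move=> c _; apply: box_coverable_sub (box_coverable_box (phi c) td0) => //.
    by move=> x [/edisk_box].
  rewrite -/P (_ : _ * (4 * _) = 4 * t ^+ 2 * (count_const * (P * alpha))); last first.
    by field; rewrite gt_eqF.
  rewrite -[leRHS]mulrA [leRHS]mulrDl; apply: (@le_trans _ _ (16 * (1 + 8 * t) ^+ 2 *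
    (count_const * (P * alpha)))).
    apply: ler_wpM2r; first exact: mulr_ge0.
    by have := sqr_ge0 t; have := ltW t0; lra.
  by rewrite [X in _ <= _ + X](_ : _ = 16 * (1 + 8 * t) ^+ 2 * (count_const * (P *
    alpha))); [rewrite lerDr|ring].
(* For [r1 < d <= r2] the disks are counted in the rectangle widened to [d], and each contributes
   only its part in the thin rectangle, of area about [r1 * d]. *)
have m0 : 0 <= 16 * (r1 * (r1 + 8 * (t * d))).
  by rewrite mulr_ge0// mulr_ge0 ?(ltW r10)// addr_ge0 ?(ltW r10)// mulr_ge0.
have count cs us (csh : forall c : R * R, c \in cs -> hits (rectangle p u r1 r2) c) :=
  @count_hits_rectangle p u d r2 cs u1 (lexx _) dr2 us
    (fun c cc => hits_sub (rectangle_sub (ltW r1d) (lexx r2)) (csh c cc)).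
apply: (final _ _ (@image_coverable (rectangle p u r1 r2) _ _ m0 count _)).
  by move=> c _; exact: disk_rectangle_coverable.
set P' := d `^ _ * _.
(* The gain [r1 / d] in area outweighs the loss from counting with width [d], because
   [kappa / 2 <= 1]. *)
have rP' : r1 * P' <= d * P.
  rewrite /P' /P !mulrA ler_wpM2r ?powR_ge0//.
  have := powR_ge_left r10 (ltW r1d) kappa2 => h.
  have := ler_wpM2r (powR_ge0 d (kappa / 2)) h; rewrite -[_ * _ * d `^ _]mulrA.
  by rewrite [d `^ (1 - _) * _]mulrC powR_split// [d * _]mulrC.
apply: (@le_trans _ _ (count_const * alpha / d ^+ 2 * (16 * ((1 + 8 * t) ^+ 2 * (d * (d *
  P)))))).
  rewrite (_ : _ * (16 * _) = count_const * alpha / d ^+ 2 * (16 * (P' * (r1 * (r1 + 8 * (t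
    * d)))))); last by ring.
  apply: ler_wpM2l; first by rewrite divr_ge0 ?(ltW d20)// mulr_ge0.
  apply: ler_wpM2l => //.
  rewrite mulrA [P' * r1]mulrC.
  rewrite (_ : (1 + 8 * t) ^+ 2 * _ = (d * P) * ((1 + 8 * t) ^+ 2 * d)); last by ring.
  have P'0 : 0 <= P' by rewrite mulr_ge0 ?powR_ge0.
  apply: ler_pM; [exact: mulr_ge0 (ltW r10) P'0 | | exact: rP' |].
    by rewrite addr_ge0 ?(ltW r10)// mulr_ge0.
  have h1 : 0 < t * d by exact: mulr_gt0.
  have h2 : 0 < t ^+ 2 * d by rewrite mulr_gt0 ?exprn_gt0.
  lra.
rewrite (_ : _ * (16 * _) = 16 * (1 + 8 * t) ^+ 2 * (count_const * (P * alpha))); last first.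
  by field; rewrite gt_eqF.
rewrite -[leRHS]mulrA [leRHS]mulrDl.
by rewrite [X in _ <= _ + X](_ : _ = 16 * (1 + 8 * t) ^+ 2 * (count_const * (P * alpha)));
  [rewrite lerDr|ring].
Qed.

(* The last term makes [(8 / image_const) `^ (kappa / 2)] small enough for the
   constant [1 / 10] of the condition on lines. *)
Definition image_const : R :=
  8 + overlap_const + 4 * t * C ^+ 2 + t * C * lower_const + 2 * rectangle_const
  + 8 * (10 * rectangle_const * image_diam) `^ (2 / kappa).

Lemma image_const_ge : [/\ 8 <= image_const, overlap_const <= image_const,
  4 * t * C ^+ 2 <= image_const, t * C * lower_const <= image_const &
  2 * rectangle_const <= image_const /\
  8 * (10 * rectangle_const * image_diam) `^ (2 / kappa) <= image_const].
Proof.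
have h1 := overlap_const_gt0; have h2 := rectangle_const_gt0.
have h3 : 0 < 4 * t * C ^+ 2 by rewrite !mulr_gt0 ?exprn_gt0.
have h4 : 0 < t * C * lower_const by apply: mulr_gt0 lower_const_gt0; exact: mulr_gt0.
have := powR_ge0 (10 * rectangle_const * image_diam) (2 / kappa).
rewrite /image_const; move: (_ `^ _) => x h5; move: h1 h2 h3 h4.
move: overlap_const rectangle_const (4 * t * C ^+ 2) (t * C * lower_const) => *.
by split; [lra|lra|lra|lra|split; lra].
Qed.

(** Points of a line have equal coordinates along its normal [u], so two points of the neighbourhood
    differ there by at most [4 * rho]; along the line the boundedness of the image limits the
    length. A rectangle of width [8 * rho] around [x0] therefore contains all of them. *)
Lemma image_line (beta : R) (l : set (R * R)) : 0 <= beta -> alpha <= lower_const * beta ->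
  is_line l ->
  (area (B `&` nbhd l image_const^-1) <= (10^-1 * beta)%:E)%E.
Proof.
move=> b0 ab [p [v [v0 ->]]].
have [M8 _ _ _ [_ Mpow]] := image_const_ge.
have M0 : 0 < image_const by apply: lt_le_trans M8.
have D1 := image_diam_ge1; have D0 := lt_le_trans ltr01 D1.
have K0 := rectangle_const_gt0.
set rho := image_const^-1; have rho0 : 0 < rho by rewrite invr_gt0.
(* The summand 8 of [image_const] puts the sides in the order required by [image_rectangle]. *)
have rho8 : 8 * rho <= image_diam.
  by apply: le_trans D1; rewrite /rho ler_pdivrMr// mul1r.
have [u [m [u1 vm]]] := unit_direction v.
have [uu rr ur ru] := dot_unit u1.
have [[x0 [Bx0 [y0 [s0 _ y0E] xy0]]]|none] :=
    pselect (exists x, (B `&` nbhd (line p v) rho) x); last first.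
  rewrite (_ : _ `&` _ = set0); first by rewrite /area measure0 lee_fin mulr_ge0.
  by apply/seteqP; split => // x Bx; apply: none; exists x.
pose p' := x0 - (4 * rho) *: u - (image_diam / 2) *: perp u.
have sub : B `&` nbhd (line p v) rho `<=` B `&` rectangle p' u (8 * rho) image_diam.
  move=> x [Bx [y [s _ yE] xy]]; split => //.
  have n1 : `|dot (x - x0) u| <= 4 * rho.
    have -> : dot (x - x0) u = dot (x - y) u - dot (x0 - y0) u.
      by rewrite -yE -y0E vm !dotB !dotD !dotZ ru; ring.
    have h1 := dot_norm (x - y) u1; have h2 := dot_norm (x0 - y0) u1.
    have h3 := norm_le_eucl_dist x y; have h4 := norm_le_eucl_dist x0 y0.
    rewrite distrC in h3; rewrite distrC in h4.
    have h5 := ler_normB (dot (x - y) u) (dot (x0 - y0) u).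
    lra.
  have n2 : `|dot (x - x0) (perp u)| <= image_diam / 2.
    apply: (le_trans (dot_norm _ (unit_perp u1))).
    have [_ [c Ec <-] /edisk_box cx] := Bx; have [_ [c0 Ec0 <-] /edisk_box cx0] := Bx0.
    have [_ _ _ diam _] := ctl.
    have h1 := diam _ _ (centre_in Ec) (centre_in Ec0).
    have h2 : `|x - x0| <= `|x - phi c| + `|phi c - phi c0| + `|x0 - phi c0|.
      rewrite -(subrKA (phi c0) x); apply: le_trans (ler_normD _ _) _.
      rewrite [X in _ + X <= _]distrC lerD2r -(subrKA (phi c) x); exact: ler_normD.
    have h3 : t * d <= t * L ^+ 2 by rewrite ler_pM2l// (radius_le Ec).
    move: cx cx0; rewrite /box /= => cx cx0; rewrite /image_diam; lra.
  apply/(rectangleP _ _ _ _ u1).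
  rewrite (_ : x - p' = (x - x0) + (4 * rho) *: u + (image_diam / 2) *: perp u); last first.
    by rewrite /p' 2!opprB [_ *: perp u + _]addrC !addrA [x + _ - x0]addrAC.
  move: (x - x0) n1 n2 => z n1 n2; rewrite !dotD !dotZ uu rr ur ru.
  move: n1 n2; rewrite !ler_norml => /andP[? ?] /andP[? ?].
  by split; apply/andP; split; lra.
apply: le_trans (le_area sub) _.
have rho80 : 0 < 8 * rho by rewrite mulr_gt0.
apply: le_trans (image_rectangle p' ab u1 rho80 rho8) _; rewrite lee_fin ler_wpM2r//.
(* Chosen so that [rectangle_const * (X^-1 * image_diam)] is exactly one tenth. *)
set X := 10 * rectangle_const * image_diam.
have X0 : 0 < X by rewrite /X; apply: mulr_gt0 D0; exact: mulr_gt0.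
have Xrho : (8 * rho) `^ (kappa / 2) <= X^-1.
  have -> : X^-1 = ((X `^ (2 / kappa))^-1) `^ (kappa / 2).
    rewrite -powRN -powRrM -powR_inv1 ?(ltW X0)//; congr (_ `^ _).
    by field; rewrite gt_eqF.
  have Xp0 : 0 < X `^ (2 / kappa) by exact: powR_gt0.
  apply: ge0_ler_powR; [by rewrite divr_ge0// ltW|by rewrite nnegrE ltW|by rewrite nnegrE
    invr_ge0 ltW|].
  by rewrite -[leRHS]mul1r ler_pdivlMr// /rho mulrAC ler_pdivrMr// mul1r.
have kappa2 : 1 - kappa / 2 <= 1 by have := kappa_gt0; lra.
have Dpow : image_diam `^ (1 - kappa / 2) <= image_diam by exact: powR_le_base1.
apply: (@le_trans _ _ (rectangle_const * (X^-1 * image_diam))).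
  by rewrite ler_pM2l// ler_pM ?powR_ge0.
rewrite le_eqVlt; apply/orP; left; apply/eqP; rewrite /X.
by field; rewrite !gt_eqF.
Qed.

Lemma image_one_set : unrectifiable_one_set (kappa / 2) image_const (t * d) B.
Proof.
have [beta [Bb bu ab]] := image_area.
have [M8 Mov M3 M4 [M5 _]] := image_const_ge.
have M0 : 0 < image_const by apply: lt_le_trans M8.
have b0 : 0 <= beta by rewrite -lee_fin -Bb; exact: measure_ge0.
have l0 := lower_const_gt0.
(* The spare factor 2 pays for enclosing a disk of radius [r] in a square of side [2 * r]. *)
have rect p u (r1 r2 : R) : eucl_dist u 0 = 1 -> 0 < r1 -> r1 <= r2 ->
    (area (B `&` rectangle p u r1 r2) <=
      (image_const / 2 * (r1 `^ (kappa / 2) * r2 `^ (1 - kappa / 2)) * beta)%:E)%E.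
  move=> u1 r10 r12; apply: le_trans (image_rectangle p ab u1 r10 r12) _.
  rewrite lee_fin ler_wpM2r// ler_wpM2r ?mulr_ge0 ?powR_ge0//.
  by rewrite ler_pdivlMr// mulrC.
split; last first.
  move=> p u r1 r2 u1 r10 r12; apply: le_trans (rect p u r1 r2 u1 r10 r12) _.
  rewrite Bb -EFinM lee_fin -[X in _ <= X * _]mulrA ler_wpM2r// ler_wpM2r ?mulr_ge0 ?powR_ge0//.
  by rewrite ler_pdivrMr// ler_peMr ?(ltW M0)// ler1n.
split.
- apply/is_ball_unionP; exists (phi @` E); split => //.
    by have [c Ec] := E_nonempty; exists (phi c); exists c.
  move=> y s us sE; apply: le_trans Mov; exact: image_overlap us sE.
- rewrite Bb !lee_fin; apply/andP; split.
    rewrite ler_pdivrMl//.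
    have h1 : d <= C * alpha by rewrite -ler_pdivrMl.
    have h2 : t * d <= t * (C * (lower_const * beta)).
      by rewrite ler_pM2l//; apply: le_trans h1 _; rewrite ler_pM2l.
    have h3 : t * C * lower_const * beta <= image_const * beta by rewrite ler_wpM2r.
    by apply: le_trans h2 _; apply: le_trans h3; rewrite !mulrA.
  have h1 : 4 * t ^+ 2 * C * alpha <= 4 * t ^+ 2 * C * (C * d).
    by rewrite ler_pM2l// !mulr_gt0 ?exprn_gt0.
  have h2 : 4 * t * C ^+ 2 * (t * d) <= image_const * (t * d) by rewrite ler_pM2r// mulr_gt0.
  by apply: le_trans bu _; apply: le_trans h1 _; apply: le_trans h2; rewrite le_eqVlt;
    apply/orP; left; apply/eqP; ring.
(* For a square the two powers multiply to the side, so the ball condition is a case of the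
   rectangle condition. *)
- move=> x r r0.
  have u1 : eucl_dist ((1, 0) : R * R) 0 = 1.
    by rewrite /eucl_dist/= !subr0 expr1n expr0n addr0 sqrtr1.
  have r20 : 0 < 2 * r by rewrite mulr_gt0.
  have := rect (x - (r, r)) (1, 0) _ _ u1 r20 (lexx _); rewrite powR_split//.
  rewrite Bb -EFinM (_ : image_const / 2 * (2 * r) * beta = image_const * r * beta); last
    by field.
  apply: le_trans; apply: le_area => y [By /edisk_box]; rewrite /box/= norm2_le => /andP[y1 y2].
  split => //; apply/(rectangleP _ _ _ _ u1).
  rewrite /dot /perp /= oppr0 !mulr0 !mulr1 add0r addr0.
  move: y1 y2; rewrite !ler_norml => /andP[? ?] /andP[? ?].
  by split; apply/andP; split; lra.
- by move=> l hl; rewrite Bb -EFinM; exact: image_line.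
Qed.
End Counting.

(** * Comparison of constants and conclusion *)

Lemma comparable_upto_ratio (R : realType) (K X Y : R) : 0 < X -> 0 < Y ->
  X / Y <= K -> Y / X <= K -> comparable_upto K X Y.
Proof.
move=> X0 Y0 XK YK; have K0 : 0 < K by apply: lt_le_trans XK; exact: divr_gt0.
rewrite /comparable_upto ler_pdivrMl// -ler_pdivrMr//.
by rewrite YK -ler_pdivrMr.
Qed.

Unset Implicit Arguments.

Theorem corollary1 (R : realType) (U V : set (R * R)) (phi : R * R -> R * R)
    (F : set (R * R)) (kappa C : R)
    (openU : open U) (openV : open V)
    (phi_diffeo : C2_diffeomorphism U V phi)
    (compactF : compact F) (FU : F `<=` U)
    (kappa_gt0 : 0 < kappa) (kappa_le : kappa <= 2^-1) (C_gt0 : 0 < C) :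
  exists2 K : R, 0 < K &
    forall (delta : R) (A : set (R * R)),
      0 < delta -> A `<=` F -> unrectifiable_one_set kappa C delta A ->
      exists2 C' : R, comparable_upto K C' C &
        equivalent_to_unrectifiable K (kappa / 2) C' delta (phi @` A).
Proof.
have [L [e [L1 e0 ctl]]] := C2_diffeomorphism_controlled openV phi_diffeo compactF FU.
have L0 : 0 < L by apply: lt_le_trans L1.
have Li0 : 0 < L^-1 by rewrite invr_gt0.
have kappa_le1 : kappa <= 1 by apply: le_trans kappa_le _; rewrite invf_le1 ?ler1n.
set M1 := image_const L e kappa C L^-1; set M2 := image_const L e kappa C L.
have M10 : 0 < M1.
  by have [M8 _ _ _ _] := image_const_ge kappa L1 e0 C_gt0 Li0; apply: lt_le_trans M8.
have M20 : 0 < M2.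
  by have [M8 _ _ _ _] := image_const_ge kappa L1 e0 C_gt0 L0; apply: lt_le_trans M8.
(* A sum of positive terms dominates each ratio that has to be bounded; it is fixed before [delta]
   and [A]. *)
pose K := 1 + L + M1 / C + C / M1 + M2 / C + C / M2.
have [r1 r2 r3 r4] : [/\ 0 < M1 / C, 0 < C / M1, 0 < M2 / C & 0 < C / M2].
  by split; exact: divr_gt0.
have [K1 KL [KM1 KM1'] [KM2 KM2']] : [/\ 1 <= K, L <= K, M1 / C <= K /\ C / M1 <= K
    & M2 / C <= K /\ C / M2 <= K].
  by rewrite /K; do ![split]; lra.
exists K => [|d A d0 AF [[/is_ball_unionP[E [E0 AE ov]] /andP[areal areau] _ _] rect]].
  exact: lt_le_trans K1.
have EF c : E c -> edisk c d `<=` F by move=> Ec x cx; apply: AF; rewrite AE; exists c.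
have Afin : area A = (fine (area A))%:E.
  rewrite fineK// ge0_fin_numE; first by apply: le_lt_trans areau _; exact: ltry.
  exact: measure_ge0.
rewrite Afin !lee_fin in areal areau; subst A.
(* Used with [t = L^-1] for the inner set and [t = L] for the outer set. *)
have one_set t (t0 : 0 < t) := image_one_set L1 e0 ctl kappa_gt0 kappa_le1 C_gt0 t0 d0
  EF ov Afin rect areal areau.
(* [C' = C] suffices, since [K] already compares [M1] and [M2] with [C]. *)
exists C; first by apply: comparable_upto_ratio; rewrite ?divff ?gt_eqF.
have [into onto _ _ _] := ctl.
exists M1, M2, (L^-1 * d), (L * d),
  (\bigcup_(z in phi @` E) edisk z (L^-1 * d)), (\bigcup_(z in phi @` E) edisk z (L * d)).
split.
- by split; exact: comparable_upto_ratio.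
- have LiK : L^-1 <= K by apply: le_trans K1; rewrite invf_le1.
  by split; apply: comparable_upto_ratio; rewrite ?mulr_gt0// ?mulfK ?gt_eqF// invfM mulrCA
    divff ?gt_eqF// mulr1 ?invrK.
- by split; exact: one_set.
- split=> [y [_ [c Ec <-]] /(onto _ _ d0 (EF _ Ec))[x cx <-]|_ [x [c Ec cx] <-]].
    by exists x => //; exists c.
  by exists (phi c); [exists c|apply: into (EF _ Ec) _ _; [|exists x]].
Qed.
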